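(* Let $\mathcal{M}\subset B(\mathcal{H})$ be a unital operator space. Suppose that $\pi:C^*(\mathcal{M})\rightarrow B(\mathcal{H}_\pi)$ is a $*$-representation possessing the approximate unique extension property with respect to $\mathcal{M}$ and let $\psi:C^*(\mathcal{M})\rightarrow B(\mathcal{H}_\pi)$ be a unital completely positive map satisfying $\psi|_{\mathcal{M}}=\pi|_{\mathcal{M}}$. Then the following statements hold. (i) There is a homomorphic conditional expectation $\Gamma_\psi:C^*(\mathrm{Im}\,\psi)\rightarrow\mathrm{Im}\,\pi$ satisfying $\Gamma_\psi\circ\psi=\pi$. (ii) If $\mathcal{H}_\pi$ is separable, then $\mathrm{rank}(\pi(t))\leq\mathrm{rank}(\psi(t))$ for each $t\in C^*(\mathcal{M})$. (iii) $\ker\Gamma_\psi$ is the smallest closed two-sided ideal of $C^*(\mathrm{Im}\,\psi)$ that contains $\mathrm{Im}(\psi-\pi)$. (iv) $\mathrm{Im}(\mathrm{id}-\Gamma_\psi)=\ker\Gamma_\psi$ and $C^*(\mathrm{Im}\,\psi)=\ker\Gamma_\psi+\mathrm{Im}\,\pi$. (v) $\psi=\pi$ if and only if $\Gamma_\psi$ is isometric.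
   Context: A unital operator space is a linear subspace $\mathcal{M}\subset B(\mathcal{H})$, $\mathcal{H}$ a Hilbert space, containing the identity; $C^*(\mathcal{M})\subset B(\mathcal{H})$ is the $C^*$-algebra it generates. $*$-representations of unital $C^*$-algebras are on Hilbert spaces and are unital. A $*$-representation $\pi:C^*(\mathcal{M})\to B(\mathcal{H}_\pi)$ has the approximate unique extension property with respect to $\mathcal{M}$ if, whenever $\psi:C^*(\mathcal{M})\to B(\mathcal{H}_\pi)$ is unital completely positive with $\psi|_{\mathcal{M}}=\pi|_{\mathcal{M}}$, there is a net of unitaries $u_\beta\in B(\mathcal{H}_\pi)$ with $u_\beta^*\psi(t)u_\beta\to\pi(t)$ in the weak operator topology for every $t\in C^*(\mathcal{M})$. $C^*(\mathrm{Im}\,\psi)\subset B(\mathcal{H}_\pi)$ is the $C^*$-algebra generated by $\mathrm{Im}\,\psi$. For $C^*$-algebras $\mathfrak{A}\subset\mathfrak{B}$, a conditional expectation $\mathfrak{B}\to\mathfrak{A}$ is a contractive linear projection of $\mathfrak{B}$ onto $\mathfrak{A}$; it is homomorphic if it is multiplicative. (Here $\mathrm{Im}\,\pi=C^*(\pi(\mathcal{M}))=C^*(\psi(\mathcal{M}))\subset C^*(\mathrm{Im}\,\psi)$.) The rank of an operator is the dimension of the closure of its range. *)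

(* Defs.v *)
From HB Require Import structures.
From mathcomp Require Import all_boot all_order all_algebra.
From mathcomp Require Import sesquilinear.
From mathcomp Require Import complex.
From mathcomp Require Import all_classical all_reals all_analysis.

Set Implicit Arguments.
Unset Strict Implicit.
Unset Printing Implicit Defensive.

Import Order.TTheory GRing.Theory Num.Theory.
Import numFieldNormedType.Exports.
Local Open Scope classical_set_scope.
Local Open Scope ring_scope.

(* Complex Hilbert spaces: the norm of a normed module over [R[i]] takes values
   in [R[i]], and sesquilinear forms are linear in the first variable. *)
HB.mixin Record isHilbert (R : realType) H & CompleteNormedModule R[i] H := {
  dotp : {dot H for (@Num.conj R[i])} ;
  dotpE : forall x : H, `|x| ^+ 2 = dotp x x
}.

#[short(type="hilbertType")]
HB.structure Definition Hilbert (R : realType) :=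
  {H of CompleteNormedModule R[i] H & isHilbert R H}.

Section BoundedOperators.
Context {R : realType} {H : hilbertType R}.

Definition bounded_op : {pred H -> H} :=
  [pred T : H -> H | `[< linear T /\ continuous T >]].

Lemma bounded_opP (T : H -> H) :
  reflect (linear T /\ continuous T) (T \in bounded_op).
Proof. exact: asboolP. Qed.

Lemma bounded_op_submod : submod_closed bounded_op.
Proof.
split.
  apply/bounded_opP; split=> [a x y|x]; first by rewrite /= scaler0 addr0.
  exact: cst_continuous.
move=> a f g /bounded_opP[lf cf] /bounded_opP[lg cg]; apply/bounded_opP; split.
  move=> b x y; rewrite !fctE lf lg !scalerDr !scalerA [a * b]mulrC.
  by rewrite -!addrA; congr (_ + _); rewrite addrCA.
by move=> x; apply: cvgD; [apply: cvgZr; exact: cf|exact: cg].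
Qed.

HB.instance Definition _ := GRing.isSubmodClosed.Build R[i] (H -> H)
  bounded_op bounded_op_submod.

Record bop := Bop { bop_fun :> H -> H ; bop_funP : bop_fun \in bounded_op }.

HB.instance Definition _ := [isSub for bop_fun].
HB.instance Definition _ := [Choice of bop by <:].
HB.instance Definition _ := [SubChoice_isSubLmodule of bop by <:].

Lemma bop_linear (T : bop) : linear T.
Proof. by have /bounded_opP[] := bop_funP T. Qed.

Lemma bop_continuous (T : bop) : continuous T.
Proof. by have /bounded_opP[] := bop_funP T. Qed.

HB.instance Definition _ (T : bop) :=
  GRing.isLinear.Build R[i] H H _ (bop_fun T) (bop_linear T).

Lemma bop1_subproof : idfun \in bounded_op.
Proof. by apply/bounded_opP; split=> // x; exact: cvg_id. Qed.

Lemma bopM_subproof (S T : bop) : S \o T \in bounded_op.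
Proof.
apply/bounded_opP; split=> [a x y /=|x]; first by rewrite !linearP.
by apply: continuous_comp; exact: bop_continuous.
Qed.

Definition bop1 := Bop bop1_subproof.
Definition bopM (S T : bop) := Bop (bopM_subproof S T).

Lemma bop_ext (S T : bop) : S =1 T -> S = T.
Proof. by move=> ST; apply/val_inj/funext. Qed.

Lemma bopMA : associative bopM. Proof. by move=> S T U; exact: bop_ext. Qed.
Lemma bop1M : left_id bop1 bopM. Proof. by move=> T; exact: bop_ext. Qed.
Lemma bopM1 : right_id bop1 bopM. Proof. by move=> T; exact: bop_ext. Qed.
Lemma bopMDl : left_distributive bopM +%R.
Proof. by move=> S T U; exact: bop_ext. Qed.
Lemma bopMDr : right_distributive bopM +%R.
Proof. by move=> S T U; apply: bop_ext => x; exact: (linearD S). Qed.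

(* Multiplication in [bop] is composition. Since [H] may be zero, [bop] is only
   a [pzRingType]. *)
HB.instance Definition _ :=
  GRing.Zmodule_isPzRing.Build bop bopMA bop1M bopM1 bopMDl bopMDr.

Lemma bop_scalerAl (a : R[i]) (S T : bop) : a *: (S * T) = a *: S * T.
Proof. exact: bop_ext. Qed.

Lemma bop_scalerAr (a : R[i]) (S T : bop) : a *: (S * T) = S * (a *: T).
Proof. by apply: bop_ext => x; exact/esym/(linearZ_LR S). Qed.

(* The operator norm is the supremum over the closed unit ball. *)
Definition opnorm (T : bop) : R :=
  sup [set complex.Re `|T x| | x in [set x : H | `|x| <= 1]].

Definition norm_closed (A : set bop) : Prop :=
  forall T, (forall e : R, 0 < e -> exists2 S, A S & opnorm (T - S) < e) -> A T.

(* The adjoint exists by the Riesz representation theorem and is unique, so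
   the default value [0] is never used. *)
Definition adjoint (T : bop) : bop :=
  xget 0 [set S : bop | forall x y : H, dotp (T x) y = dotp x (S y)].

Definition unitary (U : bop) : Prop := adjoint U * U = 1 /\ U * adjoint U = 1.

(* Weak operator convergence along a filter. *)
Definition wot_cvg {I : Type} (F : set_system I) (T_ : I -> bop) (T : bop) :
  Prop := forall x y : H, dotp (T_ i x) y @[i --> F] --> dotp (T x) y.

(* [T] is positive as an operator on the Hilbert space H^n. *)
Definition mx_positive {n : nat} (T : 'M[bop]_n) : Prop :=
  forall x : 'I_n -> H, 0 <= \sum_i \sum_j dotp (T i j (x j)) (x i).

End BoundedOperators.
Arguments bop {R} H.

Definition subspace {K : pzRingType} {V : lmodType K} (A : set V) : Prop :=
  A 0 /\ forall (a : K) x y, A x -> A y -> A (a *: x + y).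

(* Maps out of a C*-algebra [A] are total functions on B(H) of which only the
   restriction to [A] is constrained. *)
Definition linear_on {R : realType} {H K : hilbertType R}
    (A : set (bop H)) (p : bop H -> bop K) : Prop :=
  forall (a : R[i]) S T, A S -> A T -> p (a *: S + T) = a *: p S + p T.

Section Subalgebras.
Context {R : realType} {H : hilbertType R}.

Record Cstar_subalgebra (A : set (bop H)) : Prop := {
  Cstar_subspace : subspace A ;
  Cstar_mul : forall S T, A S -> A T -> A (S * T) ;
  Cstar_adjoint : forall T, A T -> A (adjoint T) ;
  Cstar_closed : norm_closed A
}.

Definition Cstar (M : set (bop H)) : set (bop H) := smallest Cstar_subalgebra M.

Definition unital_operator_space (M : set (bop H)) : Prop := subspace M /\ M 1.

Record closed_ideal (B J : set (bop H)) : Prop := {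
  ideal_sub : J `<=` B ;
  ideal_subspace : subspace J ;
  ideal_mull : forall S T, B S -> J T -> J (S * T) ;
  ideal_mulr : forall S T, J S -> B T -> J (S * T) ;
  ideal_closed : norm_closed J
}.

Record conditional_expectation (B A : set (bop H)) (E : bop H -> bop H) :
  Prop := {
  condexp_dom : Cstar_subalgebra B ;
  condexp_cod : Cstar_subalgebra A ;
  condexp_sub : A `<=` B ;
  condexp_linear : linear_on B E ;
  condexp_image : E @` B = A ;
  condexp_proj : forall T, A T -> E T = T ;
  condexp_contractive : forall T, B T -> opnorm (E T) <= opnorm T
}.

Definition homomorphic_on (B : set (bop H)) (E : bop H -> bop H) : Prop :=
  forall S T, B S -> B T -> E (S * T) = E S * E T.

End Subalgebras.

Section Maps.
Context {R : realType} {H K : hilbertType R}.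
Implicit Types (A M : set (bop H)) (p : bop H -> bop K).

Record star_representation A p : Prop := {
  rep_linear : linear_on A p ;
  rep_unital : p 1 = 1 ;
  rep_mul : forall S T, A S -> A T -> p (S * T) = p S * p T ;
  rep_adjoint : forall T, A T -> p (adjoint T) = adjoint (p T)
}.

(* An element of M_n(A) is positive iff it is positive as an operator on H^n. *)
Definition completely_positive A p : Prop :=
  forall (n : nat) (T : 'M[bop H]_n),
    (forall i j, A (T i j)) -> mx_positive T -> mx_positive (map_mx p T).

Record ucp A p : Prop := {
  ucp_linear : linear_on A p ;
  ucp_unital : p 1 = 1 ;
  ucp_cp : completely_positive A p
}.

End Maps.

Record directed {I : Type} (le : I -> I -> Prop) : Prop := {
  directed_inhabited : inhabited I ;
  directed_refl : forall i, le i i ;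
  directed_trans : forall i j k, le i j -> le j k -> le i k ;
  directed_ub : forall i j, exists2 k, le i k & le j k
}.

(* Convergence of a net indexed by [I] is convergence along this filter. *)
Definition tails {I : Type} (le : I -> I -> Prop) : set_system I :=
  [set A | exists i, [set j | le i j] `<=` A].

Definition approximate_uep {R : realType} {H K : hilbertType R}
    (M : set (bop H)) (p : bop H -> bop K) : Prop :=
  forall psi : bop H -> bop K,
    ucp (Cstar M) psi -> (forall t, M t -> psi t = p t) ->
    exists (I : Type) (le : I -> I -> Prop) (u : I -> bop K),
      [/\ directed le,
          forall i, unitary (u i) &
          forall t, Cstar M t ->
            wot_cvg (tails le) (fun i => adjoint (u i) * psi t * u i) (p t)].

Section Rank.
Context {R : realType} {H : hilbertType R}.

Definition separable : Prop := exists2 D : set H, countable D & dense D.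

Record orthonormal_basis (V E : set H) : Prop := {
  onb_sub : E `<=` V ;
  onb_norm1 : forall x, E x -> dotp x x = 1 ;
  onb_orthogonal : forall x y, E x -> E y -> x <> y -> dotp x y = 0 ;
  onb_total : V `<=` closure (smallest subspace E)
}.

(* All orthonormal bases of a closed subspace have the same cardinality, which
   is its dimension. *)
Definition dim_le (V W : set H) : Prop :=
  exists E F, [/\ orthonormal_basis V E, orthonormal_basis W F & (E #<= F)%card].

Definition rank_le (S T : bop H) : Prop :=
  dim_le (closure (range S)) (closure (range T)).

End Rank.
Arguments separable {R} H.

(* Main.v *)
(* The Schwarz inequality psi(t)^*psi(t) <= psi(t^*t) upgrades the weak limits
   u^*psi(t)u -> pi(t) to strong ones. Strong limits of bounded nets respect
   products, and the elements s for which both u^*su and u^*s^*u converge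
   strongly form a C*-algebra; it contains psi(A), hence B, and Gamma s is the
   limit of u^*su, a contractive *-homomorphism with Gamma o psi = pi. It fixes
   pi(M) = psi(M), hence pi(A). That pi(A) is closed follows by successive
   approximation: t(1 + m t^*t)^-1 with m = 1/(4|pi t|^2) has norm at most
   |pi t|, and its image is within |pi t|/4 of pi t. An element s of B lies in
   the kernel iff it equals its defect s - Gamma s, and the defects lie in any
   closed ideal that contains those of psi(A). For the rank, if psi t has finite
   rank n then the (n+1)x(n+1) minors of u^*psi(t)u vanish, and so do those of
   the limit pi t; infinite orthonormal bases are countable by separability. *)
Require Import Defs.
From mathcomp Require Import all_boot all_order all_algebra.
From mathcomp Require Import sesquilinear.
From mathcomp Require Import complex.
From mathcomp Require Import all_classical all_reals all_analysis.
From mathcomp Require Import ring lra.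

Set Implicit Arguments.
Unset Strict Implicit.
Unset Printing Implicit Defensive.

Import Order.TTheory GRing.Theory Num.Theory.
Import numFieldNormedType.Exports.
Local Open Scope classical_set_scope.
Local Open Scope ring_scope.

(* MathComp-Analysis shadows this name with the subspace topology. *)
Local Notation subspace := Defs.subspace.

(** * The real inner product *)

Section RealGeometry.
Context {R : realType} {H : hilbertType R}.
Implicit Types (x y z : H) (a : R).

(** Norms take values in [R[i]]. The real part loses nothing ([normE]) and moves estimates into an
    ordered field where [lra] and [nra] apply. *)
Definition nrm x : R := complex.Re `|x|.

(** Most estimates run through this real inner product; [Im_dotp] recovers the imaginary part by
    inserting a factor i. *)
Definition rdot x y : R := complex.Re (dotp x y).

Lemma ReD (u v : R[i]) : complex.Re (u + v) = complex.Re u + complex.Re v.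
Proof. by case: u; case: v. Qed.

Lemma ReN (u : R[i]) : complex.Re (- u) = - complex.Re u.
Proof. by case: u. Qed.

Lemma Re_conj (u : R[i]) : complex.Re (Num.conj u) = complex.Re u.
Proof. by case: u. Qed.

Lemma Im_conj (u : R[i]) : complex.Im (Num.conj u) = - complex.Im u.
Proof. by case: u. Qed.

Lemma ReZ a (u : R[i]) : complex.Re (a%:C%C * u) = a * complex.Re u.
Proof. by case: u => u v /=; rewrite mul0r subr0. Qed.

Lemma normE x : `|x| = (nrm x)%:C%C.
Proof. by rewrite RRe_real // normr_real. Qed.

Lemma nrm_ge0 x : 0 <= nrm x.
Proof. by rewrite -ler0c -normE. Qed.

Lemma nrm_eq0 x : nrm x = 0 -> x = 0.
Proof. by move=> h; apply/eqP; rewrite -normr_eq0 normE h. Qed.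

Lemma nrm_gt0 x : x != 0 -> 0 < nrm x.
Proof.
move=> x0; rewrite lt_neqAle nrm_ge0 andbT eq_sym.
by apply: contraNneq x0 => /nrm_eq0 ->.
Qed.

Lemma nrm0 : nrm 0 = 0.
Proof. by rewrite /nrm normr0. Qed.

Lemma nrmN x : nrm (- x) = nrm x.
Proof. by rewrite /nrm normrN. Qed.

Lemma nrmC x y : nrm (x - y) = nrm (y - x).
Proof. by rewrite -nrmN opprB. Qed.

Lemma nrmD x y : nrm (x + y) <= nrm x + nrm y.
Proof. by rewrite -lecR rmorphD /= -!normE ler_normD. Qed.

Lemma nrmB x y : nrm (x - y) <= nrm x + nrm y.
Proof. by rewrite -(nrmN y) nrmD. Qed.

Lemma nrm_tri z x y : nrm (x - y) <= nrm (x - z) + nrm (z - y).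
Proof. by rewrite -[x - y](subrKA z) nrmD. Qed.

Lemma nrmZ (c : R[i]) x : nrm (c *: x) = complex.Re `|c| * nrm x.
Proof. by rewrite /nrm normrZ -{1}[`|c|]RRe_real ?normr_real// ReZ. Qed.

Lemma rdotC x y : rdot x y = rdot y x.
Proof. by rewrite /rdot hermC /= expr0 mul1r Re_conj. Qed.

Lemma rdotDl x y z : rdot (x + y) z = rdot x z + rdot y z.
Proof. by rewrite /rdot linearDl ReD. Qed.

Lemma rdotNl x y : rdot (- x) y = - rdot x y.
Proof. by rewrite /rdot linearNl ReN. Qed.

Lemma rdotBl x y z : rdot (x - y) z = rdot x z - rdot y z.
Proof. by rewrite rdotDl rdotNl. Qed.

Lemma rdotZl a x y : rdot (a%:C%C *: x) y = a * rdot x y.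
Proof. by rewrite /rdot linearZl_LR ReZ. Qed.

Lemma rdotDr x y z : rdot x (y + z) = rdot x y + rdot x z.
Proof. by rewrite rdotC rdotDl !(rdotC x). Qed.

Lemma rdotNr x y : rdot x (- y) = - rdot x y.
Proof. by rewrite rdotC rdotNl rdotC. Qed.

Lemma rdotBr x y z : rdot x (y - z) = rdot x y - rdot x z.
Proof. by rewrite rdotDr rdotNr. Qed.

Lemma rdotZr a x y : rdot x (a%:C%C *: y) = a * rdot x y.
Proof. by rewrite rdotC rdotZl rdotC. Qed.

Lemma rdot0l x : rdot 0 x = 0.
Proof. by rewrite /rdot linear0l. Qed.

Lemma rdot0r x : rdot x 0 = 0.
Proof. by rewrite rdotC rdot0l. Qed.

Lemma nrm_sqr x : nrm x ^+ 2 = rdot x x.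
Proof. by rewrite /rdot -dotpE normE -rmorphXn. Qed.

Lemma Im_dotp x y : complex.Im (dotp x y) = - rdot ('i%C *: x) y.
Proof. by rewrite /rdot linearZl_LR /= mulrC ReiNIm opprK. Qed.

Lemma dotp_eqr x y (c : R[i]) : rdot x y = complex.Re c ->
  rdot ('i%C *: x) y = complex.Re ('i%C * c) -> dotp x y = c.
Proof.
move=> e1 e2; apply/eqP; rewrite eq_complex -/(rdot x y) e1 eqxx /=.
by rewrite Im_dotp e2 mulrC ReiNIm opprK.
Qed.

Lemma nrmZr a x : nrm (a%:C%C *: x) = `|a| * nrm x.
Proof. by rewrite nrmZ normc_def /= expr0n addr0 sqrtr_sqr. Qed.

Lemma nrm_sqrD x y : nrm (x + y) ^+ 2 = nrm x ^+ 2 + 2 * rdot x y + nrm y ^+ 2.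
Proof. by rewrite !nrm_sqr !rdotDl !rdotDr (rdotC y x); ring. Qed.

Lemma nrm_sqrB x y : nrm (x - y) ^+ 2 = nrm x ^+ 2 - 2 * rdot x y + nrm y ^+ 2.
Proof. by rewrite nrm_sqrD rdotNr nrmN; ring. Qed.

Lemma rdot_le x y : rdot x y <= nrm x * nrm y.
Proof.
have [->|y0] := eqVneq y 0; first by rewrite rdot0r nrm0 mulr0.
have [->|x0] := eqVneq x 0; first by rewrite rdot0l nrm0 mul0r.
(* Expanding this square gives 2 |x| |y| (|x| |y| - rdot x y) >= 0, and |x| |y| is positive. *)
have := sqr_ge0 (nrm ((nrm y)%:C%C *: x - (nrm x)%:C%C *: y)).
rewrite nrm_sqrB !nrmZr rdotZl rdotZr !ger0_norm ?nrm_ge0//.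
have := mulr_gt0 (nrm_gt0 x0) (nrm_gt0 y0); nra.
Qed.

Lemma rdot_abs x y : `|rdot x y| <= nrm x * nrm y.
Proof. by rewrite ler_norml rdot_le -(nrmN x) lerNl -rdotNl rdot_le. Qed.

Lemma rdot_inj x y : (forall z, rdot z x = rdot z y) -> x = y.
Proof.
move=> h; apply/eqP; rewrite -subr_eq0; apply/eqP/nrm_eq0/eqP.
by rewrite -sqrf_eq0 nrm_sqr rdotBr h subrr.
Qed.

Lemma nrm_le_dual x a : 0 <= a -> (forall y, rdot x y <= a * nrm y) ->
  nrm x <= a.
Proof.
move=> a0 h; have := h x; rewrite -nrm_sqr expr2.
have := nrm_ge0 x; rewrite le_eqVlt => /predU1P[<-//|x0].
by rewrite ler_pM2r.
Qed.

Lemma gt0_realC (e : R[i]) : 0 < e -> exists2 a : R, 0 < a & e = a%:C%C.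
Proof.
case: e => a b; rewrite ltcE /= => /andP[/eqP -> a0].
by exists a.
Qed.

Lemma cvg_nrmP {I : Type} (F : set_system I) {FF : Filter F} (f : I -> H) x :
  f i @[i --> F] --> x <->
  forall e : R, 0 < e -> \forall i \near F, nrm (f i - x) < e.
Proof.
split=> [/cvgrPdistC_lt cf e e0|cf].
  have /cf : (0 : R[i]) < e%:C%C by rewrite ltcR.
  by apply: filterS => i; rewrite normE ltcR.
apply/cvgrPdistC_lt => _ /gt0_realC[e e0 ->].
by apply: filterS (cf _ e0) => i; rewrite normE ltcR.
Qed.

Lemma closure_nrmP (A : set H) x : closure A x <->
  forall e : R, 0 < e -> exists2 y, A y & nrm (y - x) < e.
Proof.
split=> [cA e e0|cA B].
  have [|y [Ay /= By]] := cA (ball x (e%:C%C)).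
    by apply: nbhsx_ballx; rewrite ltcR.
  exists y => //; move: By; rewrite -ball_normE /= normE ltcR.
  by rewrite nrmC.
move=> /nbhs_ballP[_ /gt0_realC[e e0 ->]] sB.
have [y Ay xy] := cA _ e0; exists y; split=> //; apply: sB.
by rewrite -ball_normE /= normE ltcR nrmC.
Qed.

Lemma nrm_complete (u : nat -> H) :
  (forall e : R, 0 < e -> exists N, forall m n, (N <= m)%N -> (N <= n)%N ->
     nrm (u m - u n) < e) ->
  exists x, forall e : R, 0 < e -> exists N, forall n, (N <= n)%N ->
     nrm (u n - x) < e.
Proof.
move=> cu.
have /cauchy_cvgP /cvg_ex[x /cvg_nrmP ux] : cauchy (u n @[n --> \oo]).
  apply/cauchy_exP => _ /gt0_realC[e e0 ->].
  have [N hN] := cu _ e0; exists (u N); exists N => // n /= Nn.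
  by rewrite -ball_normE /= normE ltcR hN.
exists x => e /ux [N _ hN]; exists N => n Nn; exact: hN.
Qed.

End RealGeometry.

(** * Riesz representation on subspaces *)

Section Riesz.
Context {R : realType} {H : hilbertType R}.
Implicit Types (x y z : H) (A : set H).

Lemma sqrt_bound (a b c : R) : 0 <= a -> 0 <= b -> c ^+ 2 <= a ^+ 2 * b ^+ 2 ->
  `|c| <= a * b.
Proof.
move=> a0 b0 h; rewrite -[leRHS]ger0_norm ?mulr_ge0//.
by rewrite -ler_sqr ?nnegrE// !real_normK ?num_real// exprMn.
Qed.

Lemma subspaceD {V : lmodType R[i]} (A : set V) (x y : V) :
  subspace A -> A x -> A y -> A (x + y).
Proof. by move=> [_ h] Ax Ay; rewrite -(scale1r x); exact: h. Qed.

Lemma subspaceZ {V : lmodType R[i]} (A : set V) (a : R[i]) (x : V) :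
  subspace A -> A x -> A (a *: x).
Proof. by move=> [h0 h] Ax; rewrite -(addr0 (a *: x)); exact: h. Qed.

Lemma subspaceB {V : lmodType R[i]} (A : set V) (x y : V) :
  subspace A -> A x -> A y -> A (x - y).
Proof.
by move=> sA Ax Ay; rewrite -scaleN1r; apply: subspaceD => //; exact: subspaceZ.
Qed.

Definition delta (n : nat) : R := n.+1%:R^-1.

Lemma delta_gt0 n : 0 < delta n. Proof. by rewrite invr_gt0. Qed.

Lemma delta_ge0 n : 0 <= delta n. Proof. exact/ltW/delta_gt0. Qed.

Lemma delta_small (e : R) : 0 < e ->
  exists N, forall n, (N <= n)%N -> delta n < e.
Proof.
move=> e0; have [N _ hN] := near_infty_natSinv_lt (PosNum e0).
by exists N => n /hN.
Qed.

(* The vector p minimises |s|^2 - 2 Re (phi s) over the closure of A. *)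
Lemma riesz_subspace A (phi : H -> R[i]) (C : R) :
  subspace A -> (forall a x y, phi (a *: x + y) = a * phi x + phi y) ->
  (forall x, `|complex.Re (phi x)| <= C * nrm x) ->
  exists2 p, closure A p & forall s, A s -> dotp s p = phi s.
Proof.
move=> sA lphi bphi.
pose f x := complex.Re (phi x).
have fD a x y : f (a%:C%C *: x + y) = a * f x + f y.
  by rewrite /f lphi ReD ReZ.
have f0 : f 0 = 0.
  have := bphi 0; rewrite nrm0 mulr0 normr_le0 => /eqP; exact.
have fZ a x : f (a%:C%C *: x) = a * f x by rewrite -[_ *: x]addr0 fD f0 addr0.
pose J x := nrm x ^+ 2 - 2 * f x.
have Jlb : has_lbound (J @` A).
  exists (- C ^+ 2) => _ [x _ <-]; rewrite /J.
  have := bphi x; rewrite -/(f x) ler_norml => /andP[_].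
  have := sqr_ge0 (nrm x - C); nra.
have J0 : J @` A !=set0 by exists (J 0), 0 => //; case: sA.
pose d := inf (J @` A).
have dJ x : A x -> d <= J x by move=> Ax; apply: ge_inf => //; exists x.
(* A minimising sequence. The tolerance is squared because [J] is quadratic: distances and
   derivatives are then of order [delta n]. *)
have /choice[s hs] n : exists x, A x /\ J x < d + delta n ^+ 2.
  have [||_ [x Ax <-] xd] := @inf_adherent _ (J @` A) (delta n ^+ 2).
  - by rewrite exprn_gt0 ?delta_gt0.
  - by split.
  by exists x.
have J_scale x v t : J (t%:C%C *: v + x) =
    J x + t ^+ 2 * nrm v ^+ 2 + 2 * t * (rdot v x - f v).
  rewrite /J nrm_sqrD rdotZl fD nrmZr exprMn real_normK ?num_real//; ring.
have near_crit n v : A v -> `|rdot v (s n) - f v| <= delta n * nrm v.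
  move=> Av; have [Asn Jsn] := hs n.
  apply: sqrt_bound; rewrite ?nrm_ge0 ?delta_ge0//.
  have [->|v0] := eqVneq v 0.
    by rewrite rdot0l f0 nrm0 subrr expr0n /= mulr0.
  have nv0 : 0 < nrm v by exact: nrm_gt0.
  set c := rdot v (s n) - f v.
  (* This multiple of v minimises [J_scale] and lowers [J] by c^2 / |v|^2, which cannot exceed
     [delta n ^+ 2] by the choice of [s n]. *)
  have /dJ : A ((- c / nrm v ^+ 2)%:C%C *: v + s n) by case: sA => _; exact.
  rewrite J_scale -/c.
  have -> : J (s n) + (- c / nrm v ^+ 2) ^+ 2 * nrm v ^+ 2
     + 2 * (- c / nrm v ^+ 2) * c = J (s n) - c ^+ 2 / nrm v ^+ 2.
    by field; rewrite gt_eqF.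
  move=> h; rewrite -ler_pdivrMr ?exprn_gt0//.
  by move: h Jsn; lra.
have cauchy_s m n e : delta m <= e -> delta n <= e -> nrm (s m - s n) <= 2 * e.
  move=> em en; have [Am Jm] := hs m; have [An Jn] := hs n.
  have e0 : 0 <= e by exact: le_trans (delta_ge0 m) em.
  have Av : A (s m - s n) by exact: subspaceB.
  (* At the midpoint of [s m] and [s n], [J] is the mean of its two values minus |s m - s n|^2 / 4,
     and it is still at least [d]. *)
  have /dJ : A ((2^-1)%:C%C *: (s m - s n) + s n) by case: sA => _; exact.
  have := J_scale (s n) (s m - s n) 1; rewrite scale1r subrK !J_scale.
  move=> Jm' Jmid; have en2 : delta n ^+ 2 <= e ^+ 2.
    by rewrite ler_sqr ?nnegrE ?delta_ge0.
  have em2 : delta m ^+ 2 <= e ^+ 2 by rewrite ler_sqr ?nnegrE ?delta_ge0.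
  rewrite -ler_sqr ?nnegrE ?nrm_ge0 ?mulr_ge0//; lra.
have [|p hp] := nrm_complete (u := s).
  move=> e e0; have [|N hN] := delta_small (e := e / 3);
    first by rewrite divr_gt0.
  exists N => m n /hN/ltW hm /hN/ltW hn.
  by apply: le_lt_trans (cauchy_s _ _ _ hm hn) _; lra.
exists p.
  apply/closure_nrmP => e /hp[N hN]; exists (s N); first by have [] := hs N.
  exact: hN.
(* In the limit of [near_crit], the derivative of [J] at p vanishes in every direction of A. *)
have crit v : A v -> rdot v p = f v.
  move=> Av; apply/eqP; rewrite -subr_eq0 -normr_le0;
    apply/ler_addgt0Pr => e e0.
  rewrite add0r; have v0 := nrm_ge0 v.
  pose e' := e / (2 * (nrm v + 1)).
  have e'0 : 0 < e' by rewrite divr_gt0// mulr_gt0// ltr_wpDl.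
  have e'v : 2 * (e' * nrm v) <= e.
    rewrite /e' mulrAC mulrA ler_pdivrMr ?mulr_gt0 ?ltr_wpDl//; nra.
  have [N1 h1] := hp _ e'0; have [N2 h2] := delta_small e'0.
  pose n := maxn N1 N2; have sp := h1 n (leq_maxl _ _).
  have dn := h2 n (leq_maxr _ _); have cn := near_crit n v Av.
  have -> : rdot v p - f v = (rdot v (s n) - f v) - rdot v (s n - p).
    by rewrite rdotBr; ring.
  apply: le_trans (ler_normB _ _) _; apply: le_trans e'v.
  rewrite mulr2n mulrDl mul1r; apply: lerD.
    by apply: le_trans cn _; rewrite ler_wpM2r// ltW.
  apply: le_trans (rdot_abs _ _) _.
  by rewrite mulrC ler_wpM2r// ltW.
(* The real identity at v and at i v gives the complex one, since Re (i c) = - Im c. *)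
move=> v Av; apply: dotp_eqr; first exact: crit.
rewrite crit; last exact: subspaceZ.
have phi0 : phi 0 = 0.
  by have := lphi (-1) 0 0; rewrite scaler0 addr0 mulN1r addNr.
by rewrite /f -[_ *: v]addr0 lphi phi0 addr0.
Qed.

End Riesz.

(** * The operator norm *)

Section OperatorNorm.
Context {R : realType} {H : hilbertType R}.
Implicit Types (x y z : H) (S T U : bop H).

Lemma bop0r T : T 0 = 0. Proof. exact: linear0. Qed.

Lemma bopDr T x y : T (x + y) = T x + T y. Proof. exact: linearD. Qed.

Lemma bopBr T x y : T (x - y) = T x - T y. Proof. exact: linearB. Qed.

Lemma bopZr T (a : R[i]) x : T (a *: x) = a *: T x.
Proof. exact: linearZ_LR. Qed.

Lemma bop_bounded T : exists2 C : R, 0 <= C & forall x, nrm (T x) <= C * nrm x.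
Proof.
have /cvg_nrmP /(_ 1 ltr01) := @bop_continuous _ _ T 0.
move=> /nbhs_ballP[_ /gt0_realC[d d0 ->]] hd.
have {}hd y : ball (0 : H) d%:C%C y -> nrm (T y - T 0) < 1 := hd y.
exists (2 / d) => [|x]; first by rewrite divr_ge0 // ltW.
have [->|x0] := eqVneq x 0; first by rewrite bop0r !nrm0 mulr0.
have nx0 : 0 < nrm x by exact: nrm_gt0.
(* This factor brings x to norm d / 2, inside the ball on which T is bounded by 1. *)
pose a := d / (2 * nrm x).
have a0 : 0 < a by rewrite divr_gt0// mulr_gt0.
have /hd : ball (0 : H) d%:C%C (a%:C%C *: x).
  rewrite -ball_normE /= sub0r normrN normE ltcR nrmZr gtr0_norm//.
  rewrite /a invfM mulrA mulfVK ?gt_eqF//; lra.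
rewrite bop0r subr0 bopZr nrmZr gtr0_norm// => /ltW.
rewrite -ler_pdivlMl// mulr1 => /le_trans; apply.
suff -> : a^-1 = 2 / d * nrm x by [].
by rewrite /a; field; rewrite !gt_eqF.
Qed.

Let unit_ball T := [set complex.Re `|T x| | x in [set x : H | `|x| <= 1]].

Lemma unit_ballP x : (`|x| <= 1) = (nrm x <= 1).
Proof. by rewrite normE -[1 : R[i]]/(1%:C%C) lecR. Qed.

Lemma unit_ball_has_sup T : has_sup (unit_ball T).
Proof.
split; first by exists (nrm (T 0)), 0 => //=; rewrite normr0.
have [C C0 hC] := bop_bounded T; exists C => _ [x /= + <-].
rewrite unit_ballP => x1; apply: le_trans (hC x) _.
by rewrite ler_piMr.
Qed.

Lemma opnorm_ge0 T : 0 <= opnorm T.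
Proof.
apply: le_trans (nrm_ge0 (T 0)) _; apply: ub_le_sup.
  by have [] := unit_ball_has_sup T.
by exists 0 => //=; rewrite normr0.
Qed.

Lemma opnorm_ub T x : nrm (T x) <= opnorm T * nrm x.
Proof.
have [->|x0] := eqVneq x 0; first by rewrite bop0r !nrm0 mulr0.
have nx0 : 0 < nrm x by exact: nrm_gt0.
have /ub_le_sup -/(_ (nrm (T ((nrm x)^-1%:C%C *: x)))) :
  has_ubound (unit_ball T) by have [] := unit_ball_has_sup T.
rewrite bopZr nrmZr ger0_norm ?invr_ge0 ?nrm_ge0// -ler_pdivrMr// mulrC.
apply; exists ((nrm x)^-1%:C%C *: x).
  rewrite /= unit_ballP nrmZr ger0_norm ?invr_ge0 ?nrm_ge0//.
  by rewrite mulVf ?gt_eqF.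
by rewrite bopZr -/(nrm _) nrmZr ger0_norm ?invr_ge0 ?nrm_ge0// mulrC.
Qed.

Lemma opnorm_le T (C : R) : 0 <= C -> (forall x, nrm (T x) <= C * nrm x) ->
  opnorm T <= C.
Proof.
move=> C0 hC; apply: sup_le_ub; first by case: (unit_ball_has_sup T).
move=> _ [x /= + <-]; rewrite unit_ballP => x1; apply: le_trans (hC x) _.
by rewrite ler_piMr.
Qed.

Lemma opnormD S T : opnorm (S + T) <= opnorm S + opnorm T.
Proof.
apply: opnorm_le => [|x]; first by rewrite addr_ge0 ?opnorm_ge0.
by apply: le_trans (nrmD _ _) _; rewrite mulrDl lerD ?opnorm_ub.
Qed.

Lemma opnormN T : opnorm (- T) = opnorm T.
Proof.
suff h S : opnorm (- S) <= opnorm S.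
  by apply/le_anti; rewrite h -{1}(opprK T) h.
apply: opnorm_le => [|x]; first exact: opnorm_ge0.
by rewrite -[(- S) x]/(- S x) nrmN opnorm_ub.
Qed.

Lemma opnormC S T : opnorm (S - T) = opnorm (T - S).
Proof. by rewrite -opnormN opprB. Qed.

Lemma opnorm_tri U S T : opnorm (S - T) <= opnorm (S - U) + opnorm (U - T).
Proof. by rewrite -[S - T](subrKA U) opnormD. Qed.

Lemma opnormM S T : opnorm (S * T) <= opnorm S * opnorm T.
Proof.
apply: opnorm_le => [|x]; first by rewrite mulr_ge0 ?opnorm_ge0.
apply: le_trans (opnorm_ub S (T x)) _.
by rewrite -mulrA ler_wpM2l ?opnorm_ge0 ?opnorm_ub.
Qed.

Lemma opnormZ (a : R) T : opnorm (a%:C%C *: T) <= `|a| * opnorm T.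
Proof.
apply: opnorm_le => [|x]; first by rewrite mulr_ge0 ?opnorm_ge0.
rewrite -[(_ *: T) x]/(a%:C%C *: T x) nrmZr -mulrA.
by rewrite ler_wpM2l ?opnorm_ub.
Qed.

Lemma opnorm_eq0 T : opnorm T = 0 -> T = 0.
Proof.
move=> T0; apply: bop_ext => x; apply: nrm_eq0; apply/le_anti.
by rewrite nrm_ge0 andbT -(mul0r (nrm x)) -T0 opnorm_ub.
Qed.

Lemma opnorm0 : opnorm (0 : bop H) = 0.
Proof.
apply/le_anti; rewrite opnorm_ge0 andbT; apply: opnorm_le => // x.
by rewrite mul0r nrm0.
Qed.

Lemma bop_of_bounded (f : H -> H) (C : R) :
  linear f -> (forall x, nrm (f x) <= C * nrm x) ->
  exists T : bop H, forall x, T x = f x.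
Proof.
move=> lf bf; suff bof : f \in bounded_op by exists (Bop bof).
apply/bounded_opP; split=> // x; apply/cvg_nrmP => e e0.
(* C may be zero or negative, whereas the radius e / D needs a positive bound. *)
pose D := `|C| + 1; have D0 : 0 < D by rewrite ltr_wpDl.
have eD0 : 0 < e / D by rewrite divr_gt0.
have : nbhs x (ball x (e / D)%:C%C) by apply: nbhsx_ballx; rewrite ltcR.
apply: filterS => y; rewrite -ball_normE /= normE ltcR nrmC => xy.
have -> : f x - f y = f (x - y).
  by rewrite addrC -scaleN1r -lf scaleN1r addrC.
apply: le_lt_trans (bf _) _; rewrite ltr_pdivlMr// mulrC in xy.
apply: le_lt_trans xy; rewrite ler_wpM2r ?nrm_ge0//.
by rewrite (le_trans (ler_norm C))// lerDl.
Qed.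

(** Pointwise limits exist because H is complete. The Cauchy estimate is uniform over the unit ball,
    so letting one index tend to infinity makes the limit bounded and the convergence one in
    norm. *)
Lemma bop_complete (u : nat -> bop H) :
  (forall e : R, 0 < e -> exists N, forall m n, (N <= m)%N -> (N <= n)%N ->
     opnorm (u m - u n) <= e) ->
  exists T, forall e : R, 0 < e -> exists N, forall n, (N <= n)%N ->
     opnorm (u n - T) <= e.
Proof.
move=> cu.
have /choice[f hf] x : exists y, forall e : R, 0 < e ->
    exists N, forall n, (N <= n)%N -> nrm (u n x - y) < e.
  apply: nrm_complete => e e0.
  have x1 : 0 < nrm x + 1 by rewrite ltr_wpDl ?nrm_ge0.
  have [|N hN] := cu (e / (nrm x + 1)); first by rewrite divr_gt0.
  exists N => m n Nm Nn; apply: le_lt_trans (opnorm_ub (u m - u n) x) _.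
  apply: le_lt_trans (ler_wpM2r (nrm_ge0 x) (hN m n Nm Nn)) _.
  rewrite mulrAC ltr_pdivrMr// ltr_pM2l//; lra.
have near_f e : 0 < e -> exists N, forall n x, (N <= n)%N ->
    nrm (u n x - f x) <= e * nrm x.
  move=> e0; have [N hN] := cu _ e0; exists N => n x Nn.
  apply/ler_addgt0Pr => d d0; have [N' hN'] := hf x _ d0.
  apply: le_trans (nrm_tri (u (maxn N N') x) _ _) _; apply: lerD.
    apply: le_trans (opnorm_ub (u n - u (maxn N N')) x) _.
    by rewrite ler_wpM2r ?nrm_ge0// hN// leq_maxl.
  by rewrite ltW// hN'// leq_maxr.
have cvg_f x : u n x @[n --> \oo] --> f x.
  by apply/cvg_nrmP => e /(hf x)[N hN]; exists N => // n; exact: hN.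
have lf : linear f.
  move=> a x y.
  have h : a *: u n x + u n y @[n --> \oo] --> a *: f x + f y.
    by apply: cvgD => //; exact: cvgZr.
  rewrite (_ : (fun n => _) = fun n => u n (a *: x + y)) in h; last first.
    by apply/funext => n; rewrite linearP.
  exact: cvg_unique (cvg_f _) h.
have [N hN] := near_f _ ltr01.
have bf x : nrm (f x) <= (opnorm (u N) + 1) * nrm x.
  rewrite -[f x](subKr (u N x)) mulrDl; apply: le_trans (nrmB _ _) _.
  by rewrite lerD ?opnorm_ub ?hN.
have [T hT] := bop_of_bounded lf bf; exists T => e e0.
have [N' hN'] := near_f _ e0; exists N' => n Nn; apply: opnorm_le;
  first exact: ltW.
by move=> x; rewrite -[(u n - T) x]/(u n x - T x) hT; exact: hN'.
Qed.

End OperatorNorm.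

(** * Adjoints and generated C*-algebras *)

Section Adjoint.
Context {R : realType} {H : hilbertType R}.
Implicit Types (x y z : H) (S T U : bop H).

(** Riesz representation on all of H, applied to x |-> dotp (T x) y. The representing vector is
    unique, which makes it additive and homogeneous in y. *)
Lemma adjoint_exists T : exists S : bop H,
  forall x y, dotp (T x) y = dotp x (S y).
Proof.
have /choice[f hf] y : exists z, forall x, dotp (T x) y = dotp x z.
  have [|a u v|u|z _ hz] := @riesz_subspace R H setT
    (fun x => dotp (T x) y) (opnorm T * nrm y); first by split.
  - by rewrite bopDr bopZr linearPl.
  - apply: le_trans (rdot_abs _ _) _; rewrite mulrAC.
    by rewrite ler_wpM2r ?nrm_ge0 ?opnorm_ub.
  by exists z => x; rewrite hz.
have fP y : nrm (f y) <= opnorm T * nrm y.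
  apply: nrm_le_dual => [|z]; first by rewrite mulr_ge0 ?opnorm_ge0 ?nrm_ge0.
  rewrite rdotC /rdot -hf; apply: le_trans (rdot_le _ _) _.
  by rewrite mulrAC ler_wpM2r ?nrm_ge0 ?opnorm_ub.
have lf : linear f.
  move=> a u v; apply: rdot_inj => z; rewrite rdotDr /rdot -!hf.
  by rewrite linearPr /= linearZr_LR /= -!hf ReD.
by have [S hS] := bop_of_bounded lf fP; exists S => x y; rewrite hS.
Qed.

Lemma adjointP T x y : dotp (T x) y = dotp x (adjoint T y).
Proof.
have [S hS] := adjoint_exists T.
by have := @xgetPex _ 0 [set S : bop H | forall x y, dotp (T x) y = dotp x (S
  y)];
  apply; exists S.
Qed.

Lemma rdot_adjr T x y : rdot x (adjoint T y) = rdot (T x) y.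
Proof. by rewrite /rdot adjointP. Qed.

Lemma rdot_adjl T x y : rdot (adjoint T x) y = rdot x (T y).
Proof. by rewrite rdotC rdot_adjr rdotC. Qed.

Lemma adjoint_eq S T : (forall x y, rdot (T x) y = rdot x (S y)) ->
  adjoint T = S.
Proof.
by move=> h; apply: bop_ext => y; apply: rdot_inj => x; rewrite rdot_adjr.
Qed.

Lemma adjointK T : adjoint (adjoint T) = T.
Proof. by apply: adjoint_eq => x y; rewrite rdot_adjl. Qed.

Lemma adjointD S T : adjoint (S + T) = adjoint S + adjoint T.
Proof.
apply: adjoint_eq => x y.
rewrite -[(S + T) x]/(S x + T x).
rewrite -[(_ + _ : bop H) y]/(adjoint S y + adjoint T y).
by rewrite rdotDl rdotDr !rdot_adjr.
Qed.

Lemma adjointZ (a : R[i]) T : adjoint (a *: T) = Num.conj a *: adjoint T.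
Proof.
apply: adjoint_eq => x y.
rewrite -[(a *: T) x]/(a *: T x).
rewrite -[(_ *: _ : bop H) y]/(Num.conj a *: adjoint T y).
by rewrite /rdot linearZl_LR linearZr_LR /= conjCK adjointP.
Qed.

Lemma adjointN T : adjoint (- T) = - adjoint T.
Proof. by rewrite -scaleN1r adjointZ rmorphN1 scaleN1r. Qed.

Lemma adjointB S T : adjoint (S - T) = adjoint S - adjoint T.
Proof. by rewrite adjointD adjointN. Qed.

Lemma adjointM S T : adjoint (S * T) = adjoint T * adjoint S.
Proof.
apply: adjoint_eq => x y.
by rewrite -[(_ * _ : bop H) y]/(adjoint T (adjoint S y)) !rdot_adjr.
Qed.

Lemma opnorm_adjoint T : opnorm (adjoint T) = opnorm T.
Proof.
suff h S : opnorm (adjoint S) <= opnorm S.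
  by apply/le_anti; rewrite h -{1}(adjointK T) h.
apply: opnorm_le => [|x]; first exact: opnorm_ge0.
apply: nrm_le_dual => [|y]; first by rewrite mulr_ge0 ?opnorm_ge0 ?nrm_ge0.
rewrite rdot_adjl; apply: le_trans (rdot_le _ _) _.
by rewrite mulrC mulrAC ler_wpM2r ?nrm_ge0 ?opnorm_ub.
Qed.

Lemma unitary_nrm U x : unitary U -> nrm (U x) = nrm x.
Proof.
move=> [UU _]; apply/eqP; rewrite -(@eqrXn2 _ 2) ?nrm_ge0// !nrm_sqr -rdot_adjr.
by rewrite -[adjoint U (U x)]/((adjoint U * U) x) UU.
Qed.

Lemma unitary_adj_nrm U x : unitary U -> nrm (adjoint U x) = nrm x.
Proof. by move=> [UU UU']; apply: unitary_nrm; split; rewrite adjointK. Qed.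

End Adjoint.

Section CstarAlgebras.
Context {R : realType} {H : hilbertType R}.
Implicit Types (A M : set (bop H)) (S T U : bop H).

Lemma Cstar_subalgebraP M : Cstar_subalgebra (Cstar M).
Proof.
split.
- split=> [N [hN _]|a S T MS MT N MN]; first by have [[]] := hN.
  have [[[_ h] _ _ _] _] := MN; apply: h; [exact: MS | exact: MT].
- move=> S T MS MT N MN; have [[_ h _ _] _] := MN.
  by apply: h; [exact: MS | exact: MT].
- by move=> T MT N MN; have [[_ _ h _] _] := MN; apply: h; exact: MT.
move=> T hT N MN; have [[_ _ _ h] _] := MN; apply: h => e /hT[S MS ST].
by exists S => //; exact: MS.
Qed.

Lemma sub_Cstar M : M `<=` Cstar M.
Proof. by move=> T MT N [_]; exact. Qed.

Lemma Cstar_min M N : Cstar_subalgebra N -> M `<=` N -> Cstar M `<=` N.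
Proof. by move=> hN MN T; apply. Qed.

Lemma linear_on0 {K : hilbertType R} A (p : bop H -> bop K) :
  subspace A -> linear_on A p -> p 0 = 0.
Proof.
move=> [A0 _] lp; have := lp (-1) _ _ A0 A0.
by rewrite scaler0 addr0 scaleN1r addNr.
Qed.

Lemma linear_onD {K : hilbertType R} A (p : bop H -> bop K) S T :
  linear_on A p -> A S -> A T -> p (S + T) = p S + p T.
Proof. by move=> lp AS AT; have := lp 1 _ _ AS AT; rewrite !scale1r. Qed.

Lemma linear_onZ {K : hilbertType R} A (p : bop H -> bop K) a S :
  subspace A -> linear_on A p -> A S -> p (a *: S) = a *: p S.
Proof.
move=> sA lp AS; have [A0 _] := sA.
by have := lp a _ _ AS A0; rewrite (linear_on0 sA lp) !addr0.
Qed.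

Lemma linear_onB {K : hilbertType R} A (p : bop H -> bop K) S T :
  linear_on A p -> A S -> A T -> p (S - T) = p S - p T.
Proof.
move=> lp AS AT; have := lp (-1) _ _ AT AS.
by rewrite !scaleN1r ![- _ + _]addrC.
Qed.

Lemma norm_closed_limit A (u : nat -> bop H) : norm_closed A ->
  (forall n, A (u n)) ->
  (forall e : R, 0 < e -> exists N, forall m n, (N <= m)%N -> (N <= n)%N ->
     opnorm (u m - u n) <= e) ->
  exists2 T, A T & forall e : R, 0 < e -> exists N, forall n, (N <= n)%N ->
     opnorm (u n - T) <= e.
Proof.
move=> clA Au /bop_complete[T hT]; exists T => //; apply: clA => e e0.
have [|N hN] := hT (e / 2); first by rewrite divr_gt0.
exists (u N) => //; rewrite opnormC; apply: le_lt_trans (hN N (leqnn _)) _; lra.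
Qed.

End CstarAlgebras.

(** * Ranges of representations are closed *)

Section ClosedRange.
Context {R : realType}.

Lemma exprn_small (q C e : R) : 0 <= q < 1 -> 0 <= C -> 0 < e ->
  exists n, C * q ^+ n <= e.
Proof.
move=> /andP[q0 q1] C0 e0.
have d0 : 0 < e / (C + 1) by rewrite divr_gt0 ?ltr_wpDl.
have /cvg_expr/cvgrPdistC_lt/(_ _ d0)[N _ hN] : `|q| < 1 by rewrite ger0_norm.
exists N; have := hN N (leqnn N);
  rewrite /= subr0 ger0_norm ?exprn_ge0// ltr_pdivlMr ?ltr_wpDl//.
have := exprn_ge0 N q0; nra.
Qed.

Lemma geometric_cauchy {H : hilbertType R} (u : nat -> bop H) (C q : R) :
  0 <= C -> 0 <= q < 1 ->
  (forall n, opnorm (u n.+1 - u n) <= C * q ^+ n) ->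
  forall e : R, 0 < e -> exists N, forall m n, (N <= m)%N -> (N <= n)%N ->
    opnorm (u m - u n) <= e.
Proof.
move=> C0 q01 hu e e0; have /andP[q0 q1] := q01.
have q10 : 0 < 1 - q by rewrite subr_gt0.
pose D := C / (1 - q); have D0 : 0 <= D by rewrite divr_ge0// ltW.
(* The right side is the exact partial geometric sum, so the induction closes without loss. *)
have tail n k : opnorm (u (n + k)%N - u n) <= D * (q ^+ n - q ^+ (n + k)).
  elim: k => [|k IH]; first by rewrite addn0 !subrr opnorm0 mulr0.
  rewrite addnS; apply: le_trans (opnorm_tri (u (n + k)%N) _ _) _.
  apply: le_trans (lerD (hu _) IH) _.
  suff -> : C = D * (1 - q) by rewrite exprS; lra.
  by rewrite /D mulfVK ?gt_eqF.
have [N hN] := exprn_small q01 D0 (divr_gt0 e0 (ltr0n R 2)).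
have tail' m : (N <= m)%N -> opnorm (u m - u N) <= e / 2.
  move=> Nm; rewrite -(subnKC Nm); apply: le_trans (tail _ _) (le_trans _ hN).
  by rewrite ler_wpM2l// gerBl exprn_ge0.
exists N => m n /tail' hm /tail'; rewrite opnormC => hn.
apply: le_trans (opnorm_tri (u N) _ _) _; lra.
Qed.

(** * The resolvent of T^*T as a damping factor *)

Section Damping.
Context {H : hilbertType R}.
Implicit Types (A : set (bop H)) (S T r : bop H) (x y : H).

(** Both T^*T and its complement lie between 0 and |T|^2. No functional calculus is involved: the
    square of the norm is expanded and |T^*Tx| is bounded by |T| |Tx|. *)
Lemma opnorm_compl_gram T :
  opnorm ((opnorm T ^+ 2)%:C%C *: (1 : bop H) - adjoint T * T) <= opnorm T ^+ 2.
Proof.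
set t := opnorm T; apply: opnorm_le => [|x]; first by rewrite sqr_ge0.
rewrite -[_ x]/((t ^+ 2)%:C%C *: x - adjoint T (T x)).
have t0 : 0 <= t := opnorm_ge0 T.
rewrite -ler_sqr ?nnegrE ?mulr_ge0 ?sqr_ge0 ?nrm_ge0//.
rewrite nrm_sqrB rdotZl rdot_adjr -nrm_sqr nrmZr ger0_norm ?sqr_ge0//.
have : nrm (adjoint T (T x)) ^+ 2 <= (t * nrm (T x)) ^+ 2.
  rewrite ler_sqr ?nnegrE ?mulr_ge0 ?nrm_ge0// /t -(opnorm_adjoint T).
  exact: opnorm_ub.
have : 0 <= (t * nrm (T x)) ^+ 2 := sqr_ge0 _.
lra.
Qed.

(* r is the fixed point of a contraction, obtained from (1 + m T^*T) r = 1 by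
   writing m T^*T as m |T|^2 minus a positive operator. *)
Lemma resolvent_exists A T (m : R) : Cstar_subalgebra A -> A 1 -> A T ->
  0 < m -> exists2 r, A r & r + m%:C%C *: (adjoint T * T * r) = 1.
Proof.
move=> [sA mA aA cA] A1 AT m0.
pose t2 := opnorm T ^+ 2; have t20 : 0 <= t2 by exact: sqr_ge0.
pose N := 1 + m * t2; have N0 : 0 < N by rewrite ltr_pwDl// mulr_ge0// ltW.
pose g := t2%:C%C *: (1 : bop H) - adjoint T * T.
have Ag : A g.
  by apply: subspaceB => //; [exact: subspaceZ | apply: mA => //; exact: aA].
(* Since 1 + m T^*T = N - m g, the resolvent equation reads N r = 1 + m g r. As |g| <= |T|^2, [Phi]
   contracts by q = m |T|^2 / N. *)
pose Phi S := N^-1%:C%C *: (1 + m%:C%C *: (g * S)).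
have APhi S : A S -> A (Phi S).
  move=> AS; apply: subspaceZ => //; apply: subspaceD => //.
  by apply: subspaceZ => //; exact: mA.
pose q := m * t2 / N; have q01 : 0 <= q < 1.
  rewrite /q; apply/andP; split.
    exact: divr_ge0 (mulr_ge0 (ltW m0) t20) (ltW N0).
  by rewrite ltr_pdivrMr// mul1r /N ltrDr.
have /andP[q0 q1] := q01.
have PhiB S S' : opnorm (Phi S - Phi S') <= q * opnorm (S - S').
  rewrite /Phi -scalerBr.
  have -> : 1 + m%:C%C *: (g * S) - (1 + m%:C%C *: (g * S')) =
      m%:C%C *: (g * (S - S')).
    by rewrite opprD addrACA subrr add0r -scalerBr mulrBr.
  apply: le_trans (opnormZ _ _) _.
  apply: le_trans (ler_wpM2l (normr_ge0 _) (opnormZ _ _)) _.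
  apply: le_trans
    (ler_wpM2l (normr_ge0 _) (ler_wpM2l (normr_ge0 _) (opnormM _ _))) _.
  rewrite !gtr0_norm ?invr_gt0// /q [m * t2 / N]mulrC -!mulrA.
  rewrite ler_wpM2l ?invr_ge0 ?(ltW N0)// ler_wpM2l ?(ltW m0)//.
  by rewrite mulrA -expr2 ler_wpM2r ?opnorm_ge0// opnorm_compl_gram.
pose u n := iter n Phi 0.
have Au n : A (u n) by elim: n => [|n IH]; [case: sA | exact: APhi].
have hu n : opnorm (u n.+1 - u n) <= opnorm (u 1%N) * q ^+ n.
  elim: n => [|n IH]; first by rewrite subr0 expr0 mulr1.
  apply: le_trans (PhiB _ _) _; rewrite exprS mulrCA.
  by rewrite ler_wpM2l.
have [r Ar hr] := norm_closed_limit cA Au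
  (geometric_cauchy (opnorm_ge0 _) q01 hu).
exists r => //; have : r = Phi r.
  apply/eqP; rewrite -subr_eq0; apply/eqP/opnorm_eq0/le_anti.
  rewrite opnorm_ge0 andbT; apply/ler_addgt0Pr => e e0; rewrite add0r.
  have [|n0 hn] := hr (e / 2); first by rewrite divr_gt0.
  apply: le_trans (opnorm_tri (u n0.+1) _ _) _.
  have h1 := hn n0.+1 (leqnSn _); rewrite opnormC in h1.
  have h2 : opnorm (u n0.+1 - Phi r) <= e / 2.
    apply: le_trans (PhiB _ _) _; apply: le_trans (hn n0 (leqnn _)).
    by rewrite ler_piMl ?opnorm_ge0// ltW.
  lra.
move=> /(congr1 (fun S => N%:C%C *: S)); rewrite /Phi scalerA -rmorphM.
rewrite mulfV ?gt_eqF// rmorph1 scale1r /N rmorphD rmorph1 scalerDl scale1r.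
rewrite /g mulrBl scalerBr -bop_scalerAl mul1r scalerA -rmorphM => h.
apply: (@addrI _ ((m * t2)%:C%C *: r)).
by rewrite addrCA addrA h -!addrA addNr addr0 addrC.
Qed.

(** All three bounds come from x = r x + m T^*T r x. The middle one is the operator form of s / (1 +
    m s^2) <= 1 / (2 sqrt m); the last one uses T - T r = m T T^*T r. *)
Lemma resolvent_bounds T r (m : R) : 0 < m ->
    r + m%:C%C *: (adjoint T * T * r) = 1 ->
  [/\ opnorm r <= 1, 4 * m * opnorm (T * r) ^+ 2 <= 1 &
      opnorm (T - T * r) <= m * opnorm T ^+ 3].
Proof.
move=> m0 hr.
have hx x : nrm x ^+ 2 = nrm (r x) ^+ 2 + 2 * m * nrm (T (r x)) ^+ 2
    + (m * nrm (adjoint T (T (r x)))) ^+ 2.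
  have {1}-> : x = r x + m%:C%C *: adjoint T (T (r x)).
    by rewrite -[LHS]/((1 : bop H) x) -hr.
  rewrite nrm_sqrD rdotZr rdot_adjr -nrm_sqr nrmZr (gtr0_norm m0); ring.
have r1 : opnorm r <= 1.
  apply: opnorm_le => // x; rewrite mul1r -ler_sqr ?nnegrE ?nrm_ge0// (hx x).
  have := sqr_ge0 (m * nrm (adjoint T (T (r x)))).
  have := mulr_ge0 (ltW m0) (sqr_ge0 (nrm (T (r x)))); lra.
split=> //.
  have s0 : 0 < 4 * m by rewrite mulr_gt0.
  rewrite mulrC -ler_pdivlMr// div1r -[leRHS]sqr_sqrtr ?invr_ge0 ?(ltW s0)//.
  rewrite ler_sqr ?nnegrE ?sqrtr_ge0 ?opnorm_ge0//.
  apply: opnorm_le => [|x]; first exact: sqrtr_ge0.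
  rewrite -ler_sqr ?nnegrE ?mulr_ge0 ?sqrtr_ge0 ?nrm_ge0// exprMn.
  rewrite sqr_sqrtr ?invr_ge0 ?(ltW s0)// ler_pdivlMl// (hx x).
  (* By [hx], this square equals |x|^2 - 4 m |T r x|^2. *)
  have := sqr_ge0 (nrm (r x - m%:C%C *: adjoint T (T (r x)))).
  rewrite nrm_sqrB rdotZr rdot_adjr -nrm_sqr nrmZr (gtr0_norm m0).
  rewrite -[nrm ((T * r) x)]/(nrm (T (r x))).
  lra.
have -> : T - T * r = m%:C%C *: (T * (adjoint T * T * r)).
  rewrite bop_scalerAr; apply/eqP;
    rewrite subr_eq -mulrDr.
  by rewrite addrC hr mulr1.
apply: le_trans (opnormZ _ _) _; rewrite (gtr0_norm m0) ler_wpM2l ?(ltW m0)//.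
have T0 := opnorm_ge0 T.
apply: le_trans (opnormM _ _) _; rewrite exprS ler_wpM2l//.
apply: le_trans (opnormM _ _) _; rewrite -[leRHS]mulr1.
rewrite ler_pM ?opnorm_ge0// expr2 -{1}(opnorm_adjoint T); exact: opnormM.
Qed.

End Damping.

(** * The image of a contractive representation is a C*-algebra *)

Section Range.
Context {H K : hilbertType R} (A : set (bop H)) (p : bop H -> bop K).
Hypotheses (csA : Cstar_subalgebra A) (A1 : A 1).
Hypotheses (rep : star_representation A p).
Hypothesis contr : forall T, A T -> opnorm (p T) <= opnorm T.

Let sA := Cstar_subspace csA.
Let lp := rep_linear rep.

(* T' is T damped by its resolvent at the scale of the norm of p T. *)
Lemma almost_lift T : A T -> exists2 T', A T' &
  opnorm T' <= opnorm (p T) /\ opnorm (p T - p T') <= opnorm (p T) / 4.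
Proof.
move=> AT; set b := opnorm (p T).
have := opnorm_ge0 (p T); rewrite -/b le_eqVlt => /predU1P[b0|b0].
  exists 0; first by case: sA.
  rewrite (linear_on0 sA lp) subr0 opnorm0 -/b; split; lra.
(* With this m, the bound 1 / (4 m) on |T r|^2 is b^2, and the bound m b^3 on the error in the image
   is b / 4. *)
pose m := (4 * b ^+ 2)^-1; have b2 : 0 < 4 * b ^+ 2 by rewrite mulr_gt0
  ?exprn_gt0.
have m0 : 0 < m by rewrite invr_gt0.
have [r Ar hr] := resolvent_exists csA A1 AT m0.
have [_ h1 _] := resolvent_bounds m0 hr.
have ATT : A (adjoint T * T * r).
  by do 2?apply: Cstar_mul => //; exact: Cstar_adjoint.
(* So p r is the resolvent of p T, and the third bound can be used in the image. *)
have hpr : p r + m%:C%C *: (adjoint (p T) * p T * p r) = 1.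
  rewrite -(rep_unital rep) -hr (linear_onD lp)//; last exact: subspaceZ.
  rewrite (linear_onZ _ sA lp)// !(rep_mul rep) ?(rep_adjoint rep)//.
    exact: Cstar_adjoint.
  by apply: Cstar_mul => //; exact: Cstar_adjoint.
have [_ _ h3] := resolvent_bounds m0 hpr.
exists (T * r); first exact: Cstar_mul.
split.
  rewrite -ler_sqr ?nnegrE ?opnorm_ge0 ?(ltW b0)//.
  have -> : b ^+ 2 = (4 * m)^-1 by rewrite /m; field; rewrite gt_eqF.
  by rewrite -div1r ler_pdivlMr ?mulr_gt0// mulrC.
rewrite (rep_mul rep)//; apply: le_trans h3 _; rewrite -/b.
suff -> : b / 4 = m * b ^+ 3 by [].
by rewrite /m; field; rewrite gt_eqF.
Qed.

(** Each correction is lifted by [almost_lift] with norm comparable to the remaining error, so the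
    preimages themselves are Cauchy and converge in A. *)
Lemma rep_range_closed : norm_closed (p @` A).
Proof.
move=> Y hY; pose d n : R := 2^-1 ^+ n.
have d0 n : 0 < d n by rewrite exprn_gt0.
have /choice[f hf] (nS : nat * bop H) : exists S', A nS.2 ->
    opnorm (Y - p nS.2) <= d nS.1 ->
    [/\ A S', opnorm (Y - p S') <= d nS.1.+1 & opnorm (S' - nS.2) <= 2 * d
      nS.1].
  case: nS => n S /=; have [AS|] := pselect (A S); last by exists 0.
  have [hS|] := pselect (opnorm (Y - p S) <= d n); last by exists 0.
  (* With this tolerance |p (c - S)| <= 9/8 d n. The new error is then at most (1/8 + 9/32) d n,
     below d n / 2, and the correction has norm at most 2 d n. *)
  have [_ [c Ac <-] Yc] := hY (d n / 8) (divr_gt0 (d0 n) (ltr0n _ 8)).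
  have [T AT [h1 h2]] := almost_lift (subspaceB sA Ac AS).
  exists (S + T) => _ _.
  have pB : opnorm (p (c - S)) <= d n / 8 + d n.
    rewrite (linear_onB lp)//; apply: le_trans (opnorm_tri Y _ _) _.
    by rewrite lerD// opnormC ltW.
  split; first exact: subspaceD.
    have -> : Y - p (S + T) = (Y - p c) + (p (c - S) - p T).
      by rewrite (linear_onB lp)// (linear_onD lp)// opprD -[p c - p S - p
        T]addrA subrKA.
    apply: le_trans (opnormD _ _) _; apply: le_trans (lerD (ltW Yc) h2) _.
    rewrite /d exprS -/(d n); have := d0 n; lra.
  rewrite addrC addKr; have := d0 n; lra.
have [_ [S0 AS0 <-] h0] := hY 1 ltr01.
pose u := fix u n := if n is n'.+1 then f (n', u n') else S0.
have hu n : A (u n) /\ opnorm (Y - p (u n)) <= d n.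
  elim: n => [|n [IH1 IH2]]; first by rewrite /d expr0 ltW.
  by have [] := hf (n, u n) IH1 IH2.
have uB n : opnorm (u n.+1 - u n) <= 2 * 2^-1 ^+ n.
  by have [IH1 IH2] := hu n; have [] := hf (n, u n) IH1 IH2.
have half : 0 <= (2^-1 : R) < 1 by rewrite invr_ge0 ler0n invf_lt1 ?ltr1n.
have [S AS hS] := norm_closed_limit (Cstar_closed csA) (fun n => (hu n).1)
  (geometric_cauchy (ler0n _ 2) half uB).
exists S => //; apply/eqP; rewrite -subr_eq0; apply/eqP/opnorm_eq0/le_anti.
rewrite opnorm_ge0 andbT; apply/ler_addgt0Pr => e e0; rewrite add0r.
have [N hN] := hS _ (divr_gt0 e0 (ltr0n _ 2)).
have [N' hN'] := exprn_small half ler01 (divr_gt0 e0 (ltr0n _ 2)).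
pose n := maxn N N'; have [Aun Yun] := hu n.
apply: le_trans (opnorm_tri (p (u n)) _ _) _.
rewrite (splitr e); apply: lerD.
  rewrite -(linear_onB lp)//; apply: le_trans (contr _) _;
    first exact: subspaceB.
  by rewrite opnormC hN// leq_maxl.
rewrite opnormC; apply: le_trans Yun (le_trans _ hN'); rewrite mul1r.
by rewrite /d ler_wiXn2l ?leq_maxr//; lra.
Qed.

Lemma rep_range_Cstar : Cstar_subalgebra (p @` A).
Proof.
split; last exact: rep_range_closed.
- split=> [|a _ _ [S AS <-] [T AT <-]].
    by exists 0; [case: sA | exact: linear_on0 sA lp].
  by exists (a *: S + T); [case: sA => _; exact | exact: lp].
- move=> _ _ [S AS <-] [T AT <-]; exists (S * T); first exact: Cstar_mul.
  exact: rep_mul rep _ _ AS AT.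
move=> _ [T AT <-]; exists (adjoint T); first exact: Cstar_adjoint.
exact: rep_adjoint rep _ AT.
Qed.

End Range.
End ClosedRange.

(** * The Schwarz inequality *)

Section CompletelyPositive.
Context {R : realType} {H K : hilbertType R}.
Implicit Types (A : set (bop H)) (psi : bop H -> bop K) (t : bop H) (x y : K).

Lemma rdot_i {L : hilbertType R} (x y : L) :
  rdot ('i%C *: x) y = - rdot x ('i%C *: y).
Proof.
have := Im_dotp x y.
by rewrite hermC /= expr0 mul1r Im_conj Im_dotp opprK (rdotC _ x) => ->;
  rewrite opprK.
Qed.

(** Being nonnegative in [R[i]] includes being real; the second hypothesis says that the imaginary
    part vanishes. *)
Lemma positive_rdot (T : bop H) : (forall x : H, 0 <= rdot (T x) x) ->
  (forall x : H, rdot ('i%C *: T x) x = 0) ->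
  mx_positive (\matrix_(i < 1, j < 1) T).
Proof.
move=> h1 h2 x; rewrite !big_ord_recl !big_ord0 !addr0 mxE lecE /=.
by rewrite Im_dotp h2 oppr0 eqxx h1.
Qed.

Lemma ucp_positive A psi t : ucp A psi -> A t ->
    (forall x : H, 0 <= rdot (t x) x) ->
    (forall x : H, rdot ('i%C *: t x) x = 0) ->
  forall x, 0 <= rdot (psi t x) x.
Proof.
move=> [_ _ cp] At h1 h2 x.
have /(_ _)/(_ (positive_rdot h1 h2))/(_ (fun=> x)) :=
  cp 1%N (\matrix_(i, j) t).
rewrite !big_ord_recl !big_ord0 !addr0 !mxE lecE => /(_ _)/andP[] //.
by move=> i j; rewrite mxE.
Qed.

Definition gram_mx t : 'M[bop H]_2 :=
  \matrix_(i, j) (if i == 0 then if j == 0 then 1 else t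
                  else if j == 0 then adjoint t else adjoint t * t).

(* The matrix [[1, t], [t^*, t^*t]] is the Gram matrix of the row (1, t). *)
Lemma gram_mx_positive t : mx_positive (gram_mx t).
Proof.
move=> x; rewrite !big_ord_recl !big_ord0 !addr0 !mxE /=.
set y := x (lift _ _); set z := x ord0.
have -> : dotp (adjoint t z) y = dotp z (t y).
  by rewrite adjointP adjointK.
have -> : dotp ((adjoint t * t) y) y = dotp (t y) (t y).
  by rewrite -[LHS]/(dotp (adjoint t (t y)) y) adjointP adjointK.
rewrite -[dotp ((1 : bop H) z) z]/(dotp z z).
have -> : dotp z z + dotp (t y) z + (dotp z (t y) + dotp (t y) (t y)) =
    dotp (z + t y) (z + t y).
  by rewrite linearDl !linearDr /= addrACA.
by rewrite -dotpE exprn_ge0.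
Qed.

Section Schwarz.
Variables (A : set (bop H)) (psi : bop H -> bop K).
Hypotheses (csA : Cstar_subalgebra A) (A1 : A 1) (upsi : ucp A psi).

(** This is 2-positivity on [gram_mx], tested at the vector (x, y). Both the compatibility with
    adjoints and the Schwarz inequality follow by choosing x and y. *)
Lemma ucp_gram t x y : A t ->
  0 <= dotp x x + dotp (psi t y) x +
    (dotp (psi (adjoint t) x) y + dotp (psi (adjoint t * t) y) y).
Proof.
move=> At; have [_ psi1 cp] := upsi.
have /(_ _ (gram_mx_positive t))/(_ (fun i => if i == 0 then x else y)) :=
  cp 2%N (gram_mx t).
rewrite !big_ord_recl !big_ord0 !addr0 !mxE /= psi1.
apply => i j; rewrite mxE.
by case: (_ == _); case: (_ == _) => //; [exact: Cstar_adjoint|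
  apply: Cstar_mul => //; exact: Cstar_adjoint].
Qed.

(** The quantity in [ucp_gram] is real. Taking imaginary parts at (z, w), (z, 0) and (0, w) isolates
    the cross terms, which express the adjoint relation. *)
Lemma ucp_adjoint t : A t -> psi (adjoint t) = adjoint (psi t).
Proof.
move=> At; apply/esym/adjoint_eq => y x.
have Im_ge0 (z : R[i]) : 0 <= z -> complex.Im z = 0.
  by rewrite lecE => /andP[/eqP].
have g z w : rdot (psi t w) ('i%C *: z) =
    - rdot (psi (adjoint t) z) ('i%C *: w).
  have := Im_ge0 _ (ucp_gram z w At); have := Im_ge0 _ (ucp_gram 0 w At).
  have := Im_ge0 _ (ucp_gram z 0 At).
  have ImD (a b : R[i]) : complex.Im (a + b) = complex.Im a + complex.Im b.
    by case: a; case: b.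
  rewrite !bop0r !ImD !Im_dotp !rdot_i !scaler0 !rdot0r !rdot0l !opprK.
  lra.
have ii : 'i%C * 'i%C = -1 :> R[i] by rewrite -expr2 sqr_i.
(* The factor - i cancels the i in [g]. *)
have := g (- 'i%C *: x) y; rewrite scalerA mulrN ii opprK scale1r => ->.
rewrite bopZr scaleNr rdotNl rdot_i opprK scalerA ii scaleN1r rdotNr !opprK.
by rewrite rdotC.
Qed.

(** In [ucp_gram], the first entry - psi t x minimises the quadratic form for a fixed second entry
    x. *)
Lemma ucp_schwarz t x : A t ->
  nrm (psi t x) ^+ 2 <= rdot (psi (adjoint t * t) x) x.
Proof.
move=> At; have := ucp_gram (- psi t x) x At; rewrite lecE => /andP[_].
rewrite !ReD -!/(rdot _ _) ucp_adjoint// rdot_adjl !rdotNr !rdotNl -!nrm_sqr.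
rewrite /=; lra.
Qed.

(** Positivity of |t|^2 - t^*t gives psi (t^*t) <= |t|^2, and the Schwarz inequality concludes. *)
Lemma ucp_contractive t : A t -> opnorm (psi t) <= opnorm t.
Proof.
move=> At; apply: opnorm_le => [|x]; first exact: opnorm_ge0.
have sA := Cstar_subspace csA.
have Ag : A (adjoint t * t) by apply: Cstar_mul => //; exact: Cstar_adjoint.
pose s := (opnorm t ^+ 2)%:C%C *: (1 : bop H) - adjoint t * t.
have sE (z : H) : s z = (opnorm t ^+ 2)%:C%C *: z - adjoint t (t z) by [].
have s_pos z : 0 <= rdot (s z) z.
  rewrite sE rdotBl rdotZl rdot_adjl -!nrm_sqr subr_ge0 -exprMn.
  by rewrite ler_sqr ?nnegrE ?mulr_ge0 ?opnorm_ge0 ?nrm_ge0 ?opnorm_ub.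
have s_real z : rdot ('i%C *: s z) z = 0.
  have i0 (v : H) : rdot ('i%C *: v) v = 0.
    by have := rdot_i v v; rewrite (rdotC v) => h; lra.
  rewrite sE scalerBr rdotBl scalerA mulrC -scalerA rdotZl i0 mulr0 sub0r.
  by rewrite -bopZr rdot_adjl i0 oppr0.
have As : A s by apply: subspaceB => //; exact: subspaceZ.
have := ucp_positive upsi As s_pos s_real x.
have [lpsi psi1 _] := upsi.
rewrite /s (linear_onB lpsi)//; last exact: subspaceZ.
rewrite (linear_onZ _ sA lpsi)// psi1.
rewrite -[(_ - _ : bop K) x]/
  ((opnorm t ^+ 2)%:C%C *: x - psi (adjoint t * t) x).
rewrite rdotBl rdotZl -nrm_sqr => h.
rewrite -ler_sqr ?nnegrE ?mulr_ge0 ?opnorm_ge0 ?nrm_ge0// exprMn.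
by apply: le_trans (ucp_schwarz _ At) _; rewrite -subr_ge0.
Qed.

End Schwarz.
End CompletelyPositive.

(** * Strong limits of unitary conjugates *)

Section StrongLimits.
Context {R : realType} {K : hilbertType R} {I : Type} (F : set_system I).
Hypothesis PF : ProperFilter F.
Variable u : I -> bop K.
Hypothesis uU : forall i, unitary (u i).
Implicit Types (s t S T : bop K) (x y : K).

Definition uconj s (i : I) : bop K := adjoint (u i) * s * u i.

Lemma uconjE s i x : uconj s i x = adjoint (u i) (s (u i x)). Proof. by []. Qed.

Lemma uconj_nrm s i x : nrm (uconj s i x) <= opnorm s * nrm x.
Proof.
rewrite uconjE unitary_adj_nrm// -(unitary_nrm x (uU i)); exact: opnorm_ub.
Qed.

Lemma uconjP (a : R[i]) s t i :
  uconj (a *: s + t) i = a *: uconj s i + uconj t i.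
Proof. by rewrite /uconj mulrDr mulrDl -bop_scalerAr -bop_scalerAl. Qed.

Lemma uconjM s t i : uconj (s * t) i = uconj s i * uconj t i.
Proof.
have [_ uu] := uU i.
by rewrite /uconj -!mulrA; congr (_ * (_ * _)); rewrite !mulrA uu mul1r.
Qed.

Lemma uconjB s t i : uconj (s - t) i = uconj s i - uconj t i.
Proof. by rewrite -scaleN1r addrC uconjP scaleN1r addrC. Qed.

Definition sot s T := forall x, uconj s i x @[i --> F] --> T x.

Lemma sotP s T : sot s T <-> forall x e, 0 < e ->
  \forall i \near F, nrm (uconj s i x - T x) < e.
Proof. by split=> h x; [apply/cvg_nrmP|apply/cvg_nrmP => e; exact: h]. Qed.

Lemma sot_opnorm s T : sot s T -> opnorm T <= opnorm s.
Proof.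
move=> /sotP h; apply: opnorm_le => [|x]; first exact: opnorm_ge0.
apply/ler_addgt0Pr => e e0; have [i hi] := @filter_ex _ F _ _ (h x e e0).
rewrite -[T x](subKr (uconj s i x)); apply: le_trans (nrmB _ _) _.
by rewrite lerD ?uconj_nrm// ltW.
Qed.

Lemma sot_linear (a : R[i]) s t S T : sot s S -> sot t T ->
  sot (a *: s + t) (a *: S + T).
Proof.
move=> hs ht x.
rewrite (_ : (fun i => _) = fun i => a *: uconj s i x + uconj t i x);
  last first.
  by apply/funext => i; rewrite uconjP.
by apply: cvgD; [apply: cvgZr; exact: hs | exact: ht].
Qed.

(** Multiplication is jointly strongly continuous here because the left factors are bounded by
    [opnorm s] uniformly in i. *)
Lemma sotM s t S T : sot s S -> sot t T -> sot (s * t) (S * T).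
Proof.
move=> /sotP hs /sotP ht; apply/sotP => x e e0.
have s1 : 0 < opnorm s + 1 by rewrite ltr_wpDl ?opnorm_ge0.
have d0 : 0 < e / 2 / (opnorm s + 1) by rewrite !divr_gt0.
have e20 : 0 < e / 2 by rewrite divr_gt0.
apply: filterS2 (ht x _ d0) (hs (T x) _ e20) => i h1 h2.
rewrite uconjM; apply: le_lt_trans (nrm_tri (uconj s i (T x)) _ _) _.
rewrite (splitr e); apply: ler_ltD h2.
rewrite -[(uconj s i * uconj t i) x]/(uconj s i (uconj t i x)) -bopBr.
apply: le_trans (uconj_nrm _ _ _) _; move: h1; rewrite ltr_pdivlMr//.
have := nrm_ge0 (uconj t i x - T x); have := opnorm_ge0 s; nra.
Qed.

Lemma sot_unique s S T : sot s S -> sot s T -> S = T.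
Proof. by move=> hS hT; apply: bop_ext => x;
  apply: cvg_unique (hS x) (hT x). Qed.

(** A three-epsilon argument: conjugation by unitaries does not increase the norm, so approximating
    s in norm approximates all its conjugates uniformly. *)
Lemma sot_closed s T :
  (forall e : R, 0 < e -> exists s' T', [/\ sot s' T', opnorm (s - s') <= e &
     opnorm (T' - T) <= e]) -> sot s T.
Proof.
move=> h; apply/sotP => x e e0; have x0 := nrm_ge0 x.
have e3 : 0 < e / 3 by rewrite divr_gt0.
have d0 : 0 < e / 3 / (nrm x + 1) by rewrite divr_gt0// ltr_wpDl.
have dx : e / 3 / (nrm x + 1) * nrm x <= e / 3.
  rewrite mulrAC ler_pdivrMr ?ltr_wpDl// ler_wpM2l ?(ltW e3)//; lra.
have [s' [T' [/sotP hT' hs hT]]] := h _ d0.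
apply: filterS (hT' x _ e3) => i hi.
apply: le_lt_trans (nrm_tri (uconj s' i x) _ _) _.
apply: le_lt_trans (lerD (lexx _) (nrm_tri (T' x) _ _)) _.
have h1 : nrm (uconj s i x - uconj s' i x) <= e / 3.
  rewrite -[_ - _]/((uconj s i - uconj s' i) x) -uconjB;
    apply: le_trans (uconj_nrm _ _ _) _.
  by apply: le_trans dx; rewrite ler_wpM2r.
have h2 : nrm (T' x - T x) <= e / 3.
  rewrite -[_ - _]/((T' - T) x); apply: le_trans (opnorm_ub _ _) _.
  by apply: le_trans dx; rewrite ler_wpM2r.
lra.
Qed.

(** Taking adjoints is not strongly continuous; requiring convergence on both sides makes the
    convergent elements a self-adjoint set. *)
Definition bisot s T := sot s T /\ sot (adjoint s) (adjoint T).

Lemma bisot_linear (a : R[i]) s t S T : bisot s S -> bisot t T ->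
  bisot (a *: s + t) (a *: S + T).
Proof.
move=> [hs hs'] [ht ht']; split; first exact: sot_linear.
by rewrite !adjointD !adjointZ; exact: sot_linear.
Qed.

Lemma bisotM s t S T : bisot s S -> bisot t T -> bisot (s * t) (S * T).
Proof.
move=> [hs hs'] [ht ht']; split; first exact: sotM.
by rewrite !adjointM; exact: sotM.
Qed.

Lemma bisot_adjoint s T : bisot s T -> bisot (adjoint s) (adjoint T).
Proof. by move=> [h h']; split=> //; rewrite !adjointK. Qed.

Lemma bisot0 : bisot 0 0.
Proof.
have h : sot 0 0.
  move=> x; rewrite (_ : (fun i => _) = fun=> 0); first exact: cvg_cst.
  by apply/funext => i; rewrite /uconj mulr0 mul0r.
split=> //; rewrite (_ : adjoint 0 = 0)//.
by apply: adjoint_eq => x y; rewrite rdot0l rdot0r.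
Qed.

Lemma bisot_Cstar : Cstar_subalgebra [set s | exists T, bisot s T].
Proof.
split.
- split=> [|a s t [S hS] [T hT]]; first by exists 0; exact: bisot0.
  by exists (a *: S + T); exact: bisot_linear.
- by move=> s t [S hS] [T hT]; exists (S * T); exact: bisotM.
- by move=> s [S hS]; exists (adjoint S); exact: bisot_adjoint.
move=> s hs.
have /choice[v hv] n : exists v : bop K * bop K,
    bisot v.1 v.2 /\ opnorm (s - v.1) < delta n.
  by have [s' [T h] h'] := hs _ (@delta_gt0 R n); exists (s', T).
(* By [sot_opnorm], the limits are no farther apart than the approximants of s, so they are Cauchy
   as well. *)
have vB m n : opnorm ((v m).2 - (v n).2) <= delta m + delta n.
  have [[hm _] sm] := hv m; have [[hn _] sn] := hv n.
  have : sot ((v m).1 - (v n).1) ((v m).2 - (v n).2).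
    by have := sot_linear (a := -1) hn hm; rewrite !scaleN1r ![- _ + _]addrC.
  move=> /sot_opnorm h; apply: le_trans h (le_trans (opnorm_tri s _ _) _).
  by rewrite lerD ?ltW// opnormC.
have [|T hT] := bop_complete (u := fun n => (v n).2).
  move=> e e0; have [|N hN] := @delta_small R (e / 2);
    first by rewrite divr_gt0.
  exists N => m n /hN hm /hN hn; apply: le_trans (vB m n) _; lra.
have approx e : 0 < e -> exists n, opnorm (s - (v n).1) <= e /\
    opnorm ((v n).2 - T) <= e.
  move=> e0; have [N hN] := hT e e0; have [N' hN'] := delta_small e0.
  exists (maxn N N'); rewrite hN ?leq_maxl//; split=> //.
  have [_ /ltW h] := hv (maxn N N'); apply: le_trans h _.
  by rewrite ltW// hN' ?leq_maxr.
exists T; split; apply: sot_closed => e /approx[n [h1 h2]];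
  have [[hs1 hs2] _] := hv n.
  by exists (v n).1, (v n).2.
exists (adjoint (v n).1), (adjoint (v n).2).
by rewrite -!adjointB !opnorm_adjoint.
Qed.

Lemma wot_rdot (T_ : I -> bop K) T x y (e : R) : wot_cvg F T_ T -> 0 < e ->
  \forall i \near F, `|rdot (T_ i x) y - rdot (T x) y| < e.
Proof.
move=> h e0; have /cvgrPdistC_lt/(_ e%:C%C) := h x y; rewrite ltcR.
move=> /(_ e0); apply: filterS => i hi; rewrite -ltcR; apply: le_lt_trans hi.
by rewrite /rdot -ReN -ReD normc_ge_Re.
Qed.

End StrongLimits.

Lemma tails_proper {I : Type} (le : I -> I -> Prop) :
  directed le -> ProperFilter (tails le).
Proof.
move=> [[i0] refl trans ub]; split.
  by move=> [i /(_ i (refl i))].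
split=> [|P Q [i hP] [j hQ]|P Q PQ [i hP]].
- by exists i0.
- have [k ik jk] := ub i j; exists k => l kl; split.
    exact/hP/(trans _ _ _ ik).
  exact/hQ/(trans _ _ _ jk).
- by exists i => j /hP /PQ.
Qed.

(** Idempotence is stated separately, relative to a range [P]: that the range lies in B is shown
    only once the map is available. *)
Record star_retraction {R : realType} {K : hilbertType R}
    (B : set (bop K)) (G : bop K -> bop K) : Prop := {
  retr_linear : linear_on B G ;
  retr_mul : homomorphic_on B G ;
  retr_adjoint : forall s, B s -> G (adjoint s) = adjoint (G s) ;
  retr_contractive : forall s, B s -> opnorm (G s) <= opnorm s
}.

(** * The homomorphism as a strong limit of unitary conjugates *)

Section Gamma.
Context {R : realType} {H K : hilbertType R} {I : Type} (F : set_system I).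
Hypothesis PF : ProperFilter F.
Variables (u : I -> bop K) (A : set (bop H)) (pi psi : bop H -> bop K).
Hypothesis uU : forall i, unitary (u i).
Hypotheses (csA : Cstar_subalgebra A) (A1 : A 1).
Hypotheses (rep : star_representation A pi) (upsi : ucp A psi).
Hypothesis wot : forall t, A t ->
  wot_cvg F (fun i => adjoint (u i) * psi t * u i) (pi t).

(* By the Schwarz inequality |psi(t)ux|^2 <= <psi(t^*t)ux, ux>, whose limit is
   <pi(t^*t)x, x> = |pi(t)x|^2; so the weak convergence is strong. *)
Lemma psi_sot t : A t -> sot F u (psi t) (pi t).
Proof.
move=> At; apply/sotP => x e e0.
have Att : A (adjoint t * t) by apply: Cstar_mul => //; exact: Cstar_adjoint.
have d0 : 0 < e ^+ 2 / 4 by rewrite divr_gt0 ?exprn_gt0.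
apply: filterS2 (wot_rdot PF x x (wot Att) d0)
  (wot_rdot PF x (pi t x) (wot At) d0) => i.
have := ucp_schwarz csA A1 upsi (u i x) At.
rewrite (rep_mul rep) ?(rep_adjoint rep)//; last exact: Cstar_adjoint.
rewrite -[(adjoint (pi t) * pi t) x]/(adjoint (pi t) (pi t x)) !rdot_adjl.
rewrite -!nrm_sqr.
move=> h1; rewrite !ltr_norml => /andP[_ h2] /andP[h3 _].
rewrite -ltr_sqr ?nnegrE ?nrm_ge0 ?(ltW e0)// nrm_sqrB.
rewrite rdot_adjl unitary_adj_nrm//; lra.
Qed.

Lemma psi_bisot t : A t -> bisot F u (psi t) (pi t).
Proof.
move=> At; have At' : A (adjoint t) by exact: Cstar_adjoint.
split; first exact: psi_sot.
by rewrite -(ucp_adjoint csA A1 upsi At) -(rep_adjoint rep At); exact: psi_sot.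
Qed.

(** Contractivity is inherited from psi through the strong limit instead of being derived from
    spectral radii. *)
Lemma pi_contractive t : A t -> opnorm (pi t) <= opnorm t.
Proof.
move=> At; apply: le_trans (sot_opnorm PF uU (psi_sot At)) _.
exact: ucp_contractive csA A1 upsi _ At.
Qed.

Lemma star_retraction_exists : exists2 G : bop K -> bop K,
  star_retraction (Cstar (psi @` A)) G & forall t, A t -> G (psi t) = pi t.
Proof.
(* The default 0 is taken only where no limit exists, which by [BG] never happens on B. *)
pose G s := xget 0 [set T | bisot F u s T].
have GP s T : bisot F u s T -> G s = T.
  move=> hT; have hG := @xgetPex _ 0 [set T | bisot F u s T] (ex_intro _ T hT).
  exact: (sot_unique PF hG.1 hT.1).
have BG s : Cstar (psi @` A) s -> bisot F u s (G s).
  move=> /(Cstar_min (bisot_Cstar PF uU)); case.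
    by move=> _ [t At <-]; exists (pi t); exact: psi_bisot.
  by move=> T hT; rewrite (GP _ _ hT).
exists G; last by move=> t At; apply: GP; exact: psi_bisot.
split.
- by move=> a s t Bs Bt; apply: GP; apply: bisot_linear; exact: BG.
- by move=> s t Bs Bt; apply: GP; apply: bisotM => //; exact: BG.
- by move=> s Bs; apply: GP; apply: bisot_adjoint; exact: BG.
- by move=> s /BG[h _]; exact: sot_opnorm h.
Qed.

End Gamma.

(** * Orthonormal bases and rank *)

Section Orthonormal.
Context {R : realType} {K : hilbertType R}.
Implicit Types (E S V : set K) (x y z : K).

Lemma span_subspace E : subspace (smallest subspace E).
Proof.
split=> [S [[S0 _] _]//|a x y Ex Ey S SE].
by have [[_ h] _] := SE; apply: h; [exact: Ex | exact: Ey].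
Qed.

Lemma sub_span E : E `<=` smallest subspace E.
Proof. by move=> x Ex S [_]; exact. Qed.

Lemma span_min E S : subspace S -> E `<=` S -> smallest subspace E `<=` S.
Proof. by move=> sS ES x; apply. Qed.

Lemma closure_subspace S : subspace S -> subspace (closure S).
Proof.
move=> [S0 lS]; split=> [|a x y /closure_nrmP Sx /closure_nrmP Sy].
  exact: subset_closure.
apply/closure_nrmP => e e0.
have Ra : 0 <= complex.Re `|a| by rewrite normc_def /= sqrtr_ge0.
have d0 : 0 < e / 2 / (complex.Re `|a| + 1) by rewrite !divr_gt0// ltr_wpDl.
have [x' Sx' hx] := Sx _ d0; have [y' Sy' hy] := Sy _ (divr_gt0 e0 (ltr0n _ 2)).
exists (a *: x' + y'); first exact: lS.
rewrite opprD addrACA -scalerBr; apply: le_lt_trans (nrmD _ _) _.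
rewrite (splitr e) nrmZ; apply: ler_ltD hy.
move: hx; rewrite ltr_pdivlMr ?ltr_wpDl//.
have := nrm_ge0 (x' - x); nra.
Qed.

Lemma range_subspace (T : bop K) : subspace (range T).
Proof.
split=> [|a _ _ [x _ <-] [y _ <-]]; first by exists 0 => //; exact: bop0r.
by exists (a *: x + y) => //; rewrite bopDr bopZr.
Qed.

Lemma closure_orthogonal S z x : (forall s, S s -> dotp s z = 0) ->
  closure S x -> rdot x z = 0.
Proof.
move=> Sz /closure_nrmP Sx; apply/eqP; rewrite -normr_le0.
apply/ler_addgt0Pr => e e0; rewrite add0r; have z0 := nrm_ge0 z.
have d0 : 0 < e / (nrm z + 1) by rewrite divr_gt0// ltr_wpDl.
have [s Ss hs] := Sx _ d0.
have -> : rdot x z = - rdot (s - x) z.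
  by rewrite rdotBl {2}/rdot Sz// sub0r opprK.
rewrite normrN; apply: le_trans (rdot_abs _ _) _.
move: hs; rewrite ltr_pdivlMr ?ltr_wpDl//; have := nrm_ge0 (s - x); nra.
Qed.

Definition orthonormal_in V E := [/\ E `<=` V, forall x, E x -> dotp x x = 1 &
  forall x y, E x -> E y -> x <> y -> dotp x y = 0].

(** Zorn gives a maximal orthonormal set E in V. Were x in V outside the closed span, its normalised
    residual would enlarge E. *)
Lemma orthonormal_basis_exists V : subspace V -> closure V `<=` V ->
  exists E, orthonormal_basis V E.
Proof.
move=> sV cV.
have [|E [[EV E1 Eo] maxE]] := @Zorn_bigcup K (orthonormal_in V).
  move=> C CP Ctot; split.
  - by move=> x [E /CP[EV _ _] Ex]; exact: EV.
  - by move=> x [E /CP[_ E1 _] Ex]; exact: E1.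
  move=> x y [E CE Ex] [E' CE' Ey]; have [_ _ Eo] := CP _ CE.
  have [_ _ Eo'] := CP _ CE'; have [sE|sE] := Ctot _ _ CE CE'.
    by apply: Eo' => //; exact: sE.
  by apply: Eo => //; exact: sE.
exists E; split=> // x Vx.
(* Here p is the orthogonal projection of x on the closed span of E; it stays in V because V is
   closed. *)
have [a u v|u|p Ep hp] := @riesz_subspace R K _ (fun y => dotp y x) (nrm x)
  (span_subspace E).
- by rewrite linearPl.
- by rewrite mulrC; exact: rdot_abs.
have [<-//|xp] := pselect (p = x).
have Vp : V p.
  apply: cV; move: Ep; apply: closure_subset; exact: span_min.
have n0 : 0 < nrm (x - p).
  by apply: nrm_gt0; rewrite subr_eq0; apply/eqP => /esym.
pose z := (nrm (x - p))^-1%:C%C *: (x - p).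
have Ez s : E s -> dotp s z = 0.
  move=> /sub_span/hp hs; rewrite /z linearZr_LR /= linearBr /= hs subrr.
  by rewrite mulr0.
have z1 : dotp z z = 1.
  rewrite -dotpE normE nrmZr ger0_norm ?invr_ge0 ?nrm_ge0//.
  by rewrite mulVf ?gt_eqF// rmorph1 expr1n.
have nEz : ~ E z by move=> /Ez; rewrite z1 => /eqP; rewrite oner_eq0.
exfalso; apply: (maxE (E `|` [set z])).
  by split=> [y Ey|/(_ z (or_intror erefl))//]; left.
split.
- move=> y [/EV//|->]; apply: subspaceZ => //; exact: subspaceB.
- by move=> y [/E1//|->].
move=> y y' [Ey|->] [Ey'|->] // yy'; first exact: Eo.
  exact: Ez.
by rewrite hermC /= Ez// rmorph0 mulr0.
Qed.

(** Distinct orthonormal vectors are at distance sqrt 2 > 1, so points of a dense set within 1/2 of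
    them are distinct. *)
Lemma orthonormal_countable V E : separable K -> orthonormal_in V E ->
  countable E.
Proof.
move=> [D cD dD] [_ E1 Eo].
have /choice[f hf] x : exists d, D d /\ nrm (d - x) < 2^-1.
  have b0 : (ball x (2^-1 : R)%:C%C)^° !=set0.
    by exists x; apply: nbhsx_ballx; rewrite ltcR.
  have [d [/interior_subset xd Dd]] := dD _ b0 (open_interior _).
  by exists d; split=> //; move: xd; rewrite -ball_normE /= normE ltcR nrmC.
have /countable_injP[g gI] := cD.
apply/countable_injP; exists (g \o f) => x y; rewrite !inE => Ex Ey /= gfxy.
have [Dx hx] := hf x; have [Dy hy] := hf y.
have fxy : f x = f y by apply: gI => //; rewrite inE.
apply: contrapT => xy; rewrite -fxy in hy.
have : nrm (x - y) ^+ 2 = 2.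
  by rewrite nrm_sqrB !nrm_sqr /rdot !E1// Eo//= mulr0 subr0.
have := nrm_tri (f x) x y; rewrite (nrmC x (f x)).
have := nrm_ge0 (x - y); nra.
Qed.

End Orthonormal.

(** * Semicontinuity of rank through determinants *)

Section FiniteRank.
Context {R : realType} {K : hilbertType R}.
Implicit Types (x y z : K).
Local Notation C := (Num.NumField.sort (R[i] : numFieldType)).

Lemma det_cvg {T : Type} (F : set_system T) {FF : Filter F} n
    (M_ : T -> 'M[C]_n) (M : 'M[C]_n) :
  (forall j k, M_ i j k @[i --> F] --> M j k) ->
  \det (M_ i) @[i --> F] --> \det M.
Proof.
move=> hM; rewrite /determinant.
apply: (cvg_big (op := +%R)) => [|s _]; first exact: add_continuous.
apply: cvgM; first exact: cvg_cst.
have mC : continuous (fun z : C * C => z.1 * z.2) by exact: mul_continuous.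
apply: (cvg_big mC) => j _; exact: hM.
Qed.

Lemma cvg_cst_eq {T : Type} (F : set_system T) {FF : ProperFilter F} (c l : C) :
  c @[_ --> F] --> l -> l = c.
Proof. by move=> cl; exact: norm_cvg_unique cl (cvg_cst _). Qed.

Lemma det_factor0 (m n : nat) (P : 'M[C]_(m, n)) (Q : 'M[C]_(n, m)) :
  (n < m)%N -> \det (P *m Q) = 0.
Proof.
move=> nm; apply/eqP; rewrite -[_ == _]negbK -unitfE -unitmxE -row_free_unit.
rewrite /row_free neq_ltn (leq_ltn_trans (mulmx_max_rank _ _))//.
Qed.

(** The factor 2 comes from bounding real and imaginary parts separately; it is harmless for
    continuity. *)
Lemma norm_dotp_le x y : complex.Re `|dotp x y| <= 2 * (nrm x * nrm y).
Proof.
have h (z : R[i]) : complex.Re `|z| <= `|complex.Re z| + `|complex.Im z|.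
  rewrite normc_def /= -ler_sqr ?nnegrE ?sqrtr_ge0 ?addr_ge0//.
  rewrite sqr_sqrtr ?addr_ge0 ?sqr_ge0// sqrrD !real_normK ?num_real//.
  by rewrite lerD2r lerDl mulrn_wge0 ?mulr_ge0.
apply: le_trans (h _) _; rewrite Im_dotp normrN mulr2n mulrDl mul1r.
apply: lerD; first exact: rdot_abs.
apply: le_trans (rdot_abs _ _) _.
rewrite nrmZ (_ : complex.Re `|'i%C| = 1) ?mul1r//.
by rewrite normc_def /= expr0n expr1n add0r sqrtr1.
Qed.

Lemma dotp_cvgl {T : Type} (F : set_system T) {FF : Filter F} (f : T -> K) x y :
  f i @[i --> F] --> x -> dotp (f i) y @[i --> F] --> dotp x y.
Proof.
move=> /cvg_nrmP fx; apply/cvgrPdistC_lt => _ /gt0_realC[e e0 ->].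
have y0 := nrm_ge0 y.
have d0 : 0 < e / (2 * nrm y + 1) by rewrite divr_gt0// ltr_wpDl ?mulr_ge0.
apply: filterS (fx _ d0) => i; rewrite ltr_pdivlMr ?ltr_wpDl ?mulr_ge0// => hi.
rewrite -linearBl -[`|_|]RRe_real ?normr_real// ltcR.
apply: le_lt_trans (norm_dotp_le _ _) _; apply: le_lt_trans hi.
have := nrm_ge0 (f i - x); nra.
Qed.

(** The residual q is orthogonal to every [f k], hence to the closed span, which contains w, and to
    p. So |q|^2 = 0. *)
Lemma finite_onb_dotp n (f : 'I_n -> K) (E : set K) w v :
  (forall x, E x -> exists k, x = f k) ->
  (forall k l, dotp (f k) (f l) = (k == l)%:R) ->
  closure (smallest subspace E) w ->
  dotp w v = \sum_k dotp w (f k) * dotp (f k) v.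
Proof.
move=> Ef fo Ew; pose p : K := \sum_k dotp w (f k) *: f k; pose q : K := w - p.
have dotp_sum z : dotp p z =
    \sum_k dotp w (f k) * dotp (f k) z.
  by rewrite /p linear_sumlz; apply: eq_bigr => k _; rewrite linearZl_LR.
have qf k : dotp q (f k) = 0.
  rewrite /q linearBl /= dotp_sum (bigD1 k)//= fo eqxx mulr1 big1 ?addr0
    ?subrr//.
  by move=> l lk; rewrite fo (negPf lk) mulr0.
have fq k : dotp (f k) q = 0 by rewrite hermC /= qf rmorph0 mulr0.
have : rdot w q = 0.
  apply: closure_orthogonal Ew; apply: (@span_min _ _ E [set s | dotp s q = 0]).
    split=> [|a x y /= qx qy]; first by rewrite /= linear0l.
    by rewrite linearPl /= qx qy mulr0 addr0.
  by move=> x /Ef[k ->].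
rewrite -[X in rdot X _](subrK p) -/q rdotDl.
have -> : rdot p q = 0.
  by rewrite /rdot dotp_sum big1// => k _; rewrite fq mulr0.
rewrite addr0 -nrm_sqr => /eqP; rewrite sqrf_eq0 => /eqP/nrm_eq0/eqP.
by rewrite subr_eq0 => /eqP {1}->; rewrite dotp_sum.
Qed.

Section RankBound.
Context {I : Type} (F : set_system I).
Hypothesis PF : ProperFilter F.
Variables (u : I -> bop K) (S T : bop K).
Hypothesis wot : wot_cvg F (fun i => adjoint (u i) * T * u i) S.

(* The (n+1)x(n+1) matrices <T u x_j, u e_k> factor through C^n, so they are
   singular; hence so are their limits <S x_j, e_k>, and then the limits
   <e_j, e_k> of these. *)
Lemma orthonormal_in_range_le n (f : 'I_n -> K) (E : set K) (e : 'I_n.+1 -> K) :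
  (forall x, E x -> exists k, x = f k) ->
  (forall k l, dotp (f k) (f l) = (k == l)%:R) ->
  closure (range T) `<=` closure (smallest subspace E) ->
  (forall j, closure (range S) (e j)) ->
  (forall j k, dotp (e j) (e k) = (j == k)%:R) -> False.
Proof.
move=> Ef fo TE Se eo.
have det0 (x : 'I_n.+1 -> K) : \det (\matrix_(j, k) dotp (S (x j)) (e k)) = 0.
  pose M i := \matrix_(j, k) dotp ((adjoint (u i) * T * u i) (x j)) (e k).
  have detM i : \det (M i) = 0.
    have -> : M i = (\matrix_(j, l) dotp (T (u i (x j))) (f l)) *m
                    (\matrix_(l, k) dotp (f l) (u i (e k))).
      apply/matrixP => j k; rewrite !mxE.
      rewrite -[(_ * _ * _ : bop K) _]/(adjoint (u i) (T (u i (x j)))).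
      rewrite adjointP adjointK (finite_onb_dotp _ Ef fo).
        by apply: eq_bigr => l _; rewrite !mxE.
      by apply: TE; apply: subset_closure; exists (u i (x j)).
    exact: det_factor0.
  have : \det (M i) @[i --> F] --> \det (\matrix_(j, k) dotp (S (x j)) (e k)).
    apply: det_cvg => j k; rewrite mxE.
    rewrite (_ : (fun i => _) = fun i =>
      dotp ((adjoint (u i) * T * u i) (x j)) (e k)); first exact: wot.
    by apply/funext => i; rewrite mxE.
  rewrite (_ : (fun i => _) = fun=> 0); last by apply/funext => i; exact: detM.
  exact: cvg_cst_eq.
have /choice[x hx] j : exists x : nat -> K, S (x m) @[m --> \oo] --> e j.
  have /choice[x hx] m : exists x, nrm (S x - e j) < delta m.
    have /closure_nrmP/(_ _ (delta_gt0 m))[_ [x _ <-] h] := Se j.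
    by exists x.
  exists x; apply/cvg_nrmP => d /delta_small[N hN]; exists N => // m /hN.
  exact: lt_trans.
have : \det (\matrix_(j, k) dotp (S (x j m)) (e k)) @[m --> \oo] -->
    \det (1%:M : 'M[C]_n.+1).
  apply: det_cvg => j k; rewrite mxE -eo.
  rewrite (_ : (fun m => _) = fun m => dotp (S (x j m)) (e k)).
    exact: dotp_cvgl.
  by apply/funext => m; rewrite mxE.
rewrite (_ : (fun m => _) = fun=> 0); last by apply/funext => m; exact: det0.
rewrite det1 => h; have : (1 : R[i]) = 0 by exact: cvg_cst_eq h.
by move/eqP; rewrite oner_eq0.
Qed.

Lemma wot_rank_le : separable K -> rank_le S T.
Proof.
move=> sepK.
have basis (U : bop K) : exists E, orthonormal_basis (closure (range U)) E.
  apply: orthonormal_basis_exists.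
    exact: closure_subspace (range_subspace U).
  by rewrite -(closure_id _).1//; exact: closed_closure.
have [E onbE] := basis S; have [D onbD] := basis T.
exists E, D; split=> //.
(* If D is infinite, any orthonormal set embeds in it, being countable. *)
have [infD|] := pselect ([set: nat] #<= D)%card.
  apply: card_le_trans infD; case: onbE => h1 h2 h3 _.
  exact: (orthonormal_countable sepK (And3 h1 h2 h3)).
move=> /finite_setPn [n Dn]; apply: contrapT => nED.
(* If E does not embed in the n-element set D, it is infinite or has more than n elements; either
   way it contains n + 1 of them. *)
have En : (`I_n.+1 #<= E)%card.
  have [/finite_setPn[m Em]|/contrapT infE] :=
    pselect (~ ([set: nat] #<= E)%card).
    rewrite (card_le_eqr Em) card_le_II ltnNge; apply/negP => mn.
    by apply: nED; rewrite (card_le_eql Em) (card_le_eqr Dn) card_le_II.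
  exact: card_le_trans (card_leT _) infE.
have /pcard_leP[e] : ([set: 'I_n.+1] #<= E)%card.
  by rewrite -(card_le_eql card_II).
have /pcard_eqP[f] : ([set: 'I_n] #= D)%card.
  apply: card_esym; exact: card_eq_trans Dn card_II.
case: onbE => ES E1 Eo _; case: onbD => DT D1 Do Dtot.
have orth m (g : 'I_m -> K) (C : set K) : (forall x, C x -> dotp x x = 1) ->
    (forall x y, C x -> C y -> x <> y -> dotp x y = 0) ->
    (forall k, C (g k)) -> injective g ->
    forall k l, dotp (g k) (g l) = (k == l)%:R.
  move=> C1 Co Cg gI k l; have [->|/eqP kl] := eqVneq k l; first exact: C1.
  by apply: Co => // /gI.
apply: (@orthonormal_in_range_le n f D e) => //.
- by move=> x Dx; have [k _ <-] := @surj _ _ _ _ f x Dx; exists k.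
- by apply: (orth _ f D D1 Do) => [k|k l fkl]; [exact: funS |];
    exact: (in2TT 'inj_f) fkl.
- by move=> j; apply: ES; exact: funS.
by apply: (orth _ e E E1 Eo) => [k|k l ekl]; [exact: funS |];
  exact: (in2TT 'inj_e) ekl.
Qed.

End RankBound.
End FiniteRank.

(** * The retraction onto the range *)

Section Retraction.
Context {R : realType} {K : hilbertType R} (B P : set (bop K)).
Variable G : bop K -> bop K.
Hypotheses (csB : Cstar_subalgebra B) (csP : Cstar_subalgebra P).
Hypothesis retr : star_retraction B G.

Let sB := Cstar_subspace csB.
Let lG := retr_linear retr.
Let ker := [set s | B s /\ G s = 0].

(** Applied with [Cstar_min]: once this algebra contains the generators of B, G maps all of B into
    P. *)
Lemma retraction_preim_Cstar : Cstar_subalgebra [set s | B s /\ P (G s)].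
Proof.
have [B0 lB] := sB; have [P0 lP] := Cstar_subspace csP.
split.
- split=> [|a s t [Bs Ps] [Bt Pt]]; first by split=> //;
    rewrite (linear_on0 sB lG).
  by split; [exact: lB | rewrite lG//; exact: lP].
- move=> s t [Bs Ps] [Bt Pt]; split; first exact: Cstar_mul.
  by rewrite (retr_mul retr)//; exact: Cstar_mul.
- move=> s [Bs Ps]; split; first exact: Cstar_adjoint.
  by rewrite (retr_adjoint retr)//; exact: Cstar_adjoint.
move=> s hs; have Bs : B s.
  by apply: (Cstar_closed csB) => e /hs[t [Bt _] st]; exists t.
split=> //; apply: (Cstar_closed csP) => e /hs[t [Bt Pt] st].
exists (G t) => //; apply: le_lt_trans st; rewrite -(linear_onB lG)//.
by apply: (retr_contractive retr); exact: subspaceB.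
Qed.

Lemma ker_closed_ideal : closed_ideal B ker.
Proof.
have [B0 lB] := sB.
split=> [s []//||s t Bs [Bt t0]|s t [Bs s0] Bt|s hs].
- split=> [|a s t [Bs s0] [Bt t0]]; first by split=> //;
    exact: linear_on0 sB lG.
  by split; [exact: lB | rewrite lG// s0 t0 scaler0 addr0].
- by split; [exact: Cstar_mul | rewrite (retr_mul retr)// t0 mulr0].
- by split; [exact: Cstar_mul | rewrite (retr_mul retr)// s0 mul0r].
have Bs : B s by apply: (Cstar_closed csB) => e /hs[t [Bt _] st]; exists t.
split=> //; apply/opnorm_eq0/le_anti; rewrite opnorm_ge0 andbT.
apply/ler_addgt0Pr => e /hs[t [Bt t0] st]; rewrite add0r.
rewrite -[G s]subr0 -t0 -(linear_onB lG)//; apply: le_trans (ltW st).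
by apply: (retr_contractive retr); exact: subspaceB.
Qed.

Hypothesis PB : P `<=` B.
Hypothesis GP : forall s, P s -> G s = s.
Hypothesis G_into : forall s, B s -> P (G s).

Lemma sub_retr_ker s : B s -> ker (s - G s).
Proof.
move=> Bs; have PGs := G_into Bs; have BGs := PB PGs; split.
  exact: subspaceB.
by rewrite (linear_onB lG)// (GP PGs) subrr.
Qed.

(* Closed ideals are not assumed self-adjoint, hence the condition on both s
   and its adjoint, which cuts out a C*-algebra. *)
Lemma ideal_defect_Cstar J : closed_ideal B J -> Cstar_subalgebra
  [set s | [/\ B s, J (s - G s) & J (adjoint s - G (adjoint s))]].
Proof.
move=> idJ; have [J0 lJ] := ideal_subspace idJ; have [B0 lB] := sB.
have aB s : B s -> B (adjoint s) by exact: Cstar_adjoint.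
have BG s : B s -> B (G s) by move=> /G_into/PB.
have JL (a : R[i]) s t : B s -> B t -> J (s - G s) -> J (t - G t) ->
    J (a *: s + t - G (a *: s + t)).
  move=> Bs Bt Js Jt; rewrite lG// opprD addrACA -scalerBr; exact: lJ.
have JM s t : B s -> B t -> J (s - G s) -> J (t - G t) -> J (s * t - G (s * t)).
  move=> Bs Bt Js Jt; rewrite (retr_mul retr)//.
  have -> : s * t - G s * G t = (s - G s) * t + G s * (t - G t).
    by rewrite mulrBl mulrBr subrKA.
  apply: subspaceD (ideal_subspace idJ) _ _;
    first exact: ideal_mulr idJ _ _ Js Bt.
  exact: ideal_mull idJ _ _ (BG _ Bs) Jt.
have Jcl s : B s -> (forall e : R, 0 < e -> exists t,
    [/\ B t, J (t - G t) & opnorm (s - t) < e]) -> J (s - G s).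
  move=> Bs hs; apply: (ideal_closed idJ) => e e0.
  (* Half of e suffices: G is contractive, so the defect of s - t has norm at most 2 |s - t|. *)
  have [t [Bt Jt st]] := hs _ (divr_gt0 e0 (ltr0n R 2)); exists (t - G t) => //.
  have -> : s - G s - (t - G t) = (s - t) - G (s - t).
    by rewrite (linear_onB lG)// !opprD !opprK addrACA.
  apply: le_lt_trans (opnormD _ _) _; rewrite opnormN.
  have := retr_contractive retr (subspaceB sB Bs Bt); lra.
split.
- split=> [|a s t [Bs Js Js'] [Bt Jt Jt']].
    have a0 : adjoint 0 = 0 :> bop K by rewrite -(scale0r 0) adjointZ rmorph0
      !scale0r.
    by split=> //; rewrite ?a0 (linear_on0 sB lG) subr0.
  split; [exact: lB | exact: JL |].
  by rewrite adjointD adjointZ; apply: JL => //; exact: aB.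
- move=> s t [Bs Js Js'] [Bt Jt Jt']; split; [exact: Cstar_mul | exact: JM |].
  by rewrite adjointM; apply: JM => //; exact: aB.
- by move=> s [Bs Js Js']; split; rewrite ?adjointK//; exact: aB.
move=> s hs; have Bs : B s.
  by apply: (Cstar_closed csB) => e /hs[t [Bt _] st]; exists t.
split=> //; first by apply: Jcl => // e /hs[t [Bt Jt _] st]; exists t.
apply: Jcl => [|e /hs[t [Bt _ Jt] st]]; first exact: aB.
exists (adjoint t).
by rewrite -adjointB opnorm_adjoint; split=> //; exact: aB.
Qed.

End Retraction.

(** * The homomorphic conditional expectation onto the range of pi *)

Theorem theorem4p1 (R : realType) (H K : hilbertType R) (M : set (bop H))
    (pi psi : bop H -> bop K) :
  unital_operator_space M ->
  star_representation (Cstar M) pi ->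
  approximate_uep M pi ->
  ucp (Cstar M) psi ->
  (forall t, M t -> psi t = pi t) ->
  let A := Cstar M in
  let B := Cstar (psi @` A) in
  exists Gamma : bop K -> bop K,
    let kerG := [set s | B s /\ Gamma s = 0] in
    [/\ (* (i) *)
        [/\ conditional_expectation B (pi @` A) Gamma,
            homomorphic_on B Gamma &
            forall t, A t -> Gamma (psi t) = pi t],
        (* (ii) *)
        separable K -> forall t, A t -> rank_le (pi t) (psi t),
        (* (iii) *)
        [/\ closed_ideal B kerG,
            [set psi t - pi t | t in A] `<=` kerG &
            forall J, closed_ideal B J ->
              [set psi t - pi t | t in A] `<=` J -> kerG `<=` J],
        (* (iv) *)
        [set s - Gamma s | s in B] = kerG /\
        B = [set k + p | k in kerG & p in pi @` A] &
        (* (v) *)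
        (forall t, A t -> psi t = pi t) <->
        (forall s, B s -> opnorm (Gamma s) = opnorm s)].
Proof.
move=> [sM M1] rep uep upsi psiM A B.
have csA : Cstar_subalgebra A := Cstar_subalgebraP M.
have csB : Cstar_subalgebra B := Cstar_subalgebraP _.
have A1 : A 1 by exact: sub_Cstar.
have sA := Cstar_subspace csA; have sB := Cstar_subspace csB.
have [I [le [u [dle uU wot]]]] := uep psi upsi psiM.
have PF := tails_proper dle.
have pi_c := pi_contractive PF uU csA A1 rep upsi wot.
have [G retr Gpsi] := star_retraction_exists PF uU csA A1 rep upsi wot.
have lG := retr_linear retr; have lpi := rep_linear rep.
have csP := rep_range_Cstar csA A1 rep pi_c.
have Bpsi t : A t -> B (psi t) by move=> At; apply: sub_Cstar; exists t.
have aP t : A t -> pi (adjoint t) = adjoint (pi t) by exact: rep_adjoint.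
(* As psi and pi agree only on M, the elements t with pi t in B and fixed by G are shown to form a
   C*-algebra; it contains M, hence is A. *)
have piB : forall t, A t -> B (pi t) /\ G (pi t) = pi t.
  suff : A `<=` [set t | A t /\ (B (pi t) /\ G (pi t) = pi t)].
    by move=> h t /h[].
  apply: Cstar_min => [|t Mt]; last first.
    have At : A t by exact: sub_Cstar.
    rewrite /= -(psiM t Mt) Gpsi// (psiM t Mt); split=> //; split=> //.
    by rewrite -(psiM t Mt); exact: Bpsi.
  have [A0 lA] := sA; have [B0 lB] := sB.
  split.
  - split=> [|a s t [As [Bs Gs]] [At [Bt Gt]]].
      by rewrite /= (linear_on0 sA lpi) (linear_on0 sB lG).
    rewrite /= lpi// lG// Gs Gt; split; first exact: lA.
    by split=> //; exact: lB.
  - move=> s t [As [Bs Gs]] [At [Bt Gt]].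
    rewrite /= (rep_mul rep)// (retr_mul retr)// Gs Gt.
    by split; [exact: (Cstar_mul csA) | split=> //; exact: (Cstar_mul csB)].
  - move=> t [At [Bt Gt]]; rewrite /= aP// (retr_adjoint retr)// Gt.
    by split; [exact: (Cstar_adjoint csA) | split=> //;
      exact: (Cstar_adjoint csB)].
  move=> t ht; have At : A t.
    by apply: (Cstar_closed csA) => e /ht[s [As _] st]; exists s.
  have near e : 0 < e -> exists s, [/\ B (pi s), G (pi s) = pi s &
      opnorm (pi t - pi s) < e].
    move=> /ht[s [As [Bs Gs]] st]; exists s; split=> //.
    rewrite -(linear_onB lpi)//; apply: le_lt_trans st.
    by apply: pi_c; exact: subspaceB sA At As.
  have Bt : B (pi t).
    by apply: (Cstar_closed csB) => e /near[s [Bs _ st]]; exists (pi s).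
  split=> //; split=> //; apply/eqP; rewrite -subr_eq0;
    apply/eqP/opnorm_eq0/le_anti.
  rewrite opnorm_ge0 andbT; apply/ler_addgt0Pr => e e0; rewrite add0r.
  have [s [Bs Gs st]] := near _ (divr_gt0 e0 (ltr0n R 2)).
  apply: le_trans (opnorm_tri (pi s) _ _) _; rewrite -{1}Gs -(linear_onB lG)//.
  rewrite (opnormC (pi s)) (splitr e) lerD ?(ltW st)//.
  apply: le_trans (ltW st); apply: (retr_contractive retr).
  exact: subspaceB sB Bt Bs.
have PB : pi @` A `<=` B by move=> _ [t At <-]; have [] := piB t At.
have GP p : (pi @` A) p -> G p = p by move=> [t At <-]; have [] := piB t At.
have GB s : B s -> (pi @` A) (G s).
  suff /(_ s) h : B `<=` [set s | B s /\ (pi @` A) (G s)] by move=> /h[].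
  apply: Cstar_min; first exact: retraction_preim_Cstar.
  by move=> _ [t At <-]; split; [exact: Bpsi | rewrite Gpsi//; exists t].
have kerB := sub_retr_ker csB retr PB GP GB.
exists G; split.
- split=> //; last exact: retr_mul.
  split=> //; last exact: retr_contractive.
  apply/seteqP; split=> [_ [s Bs <-]|p Pp]; first exact: GB.
  by exists p; [exact: PB | exact: GP].
- by move=> sepK t At; exact: (wot_rank_le PF (wot t At) sepK).
(* By [ideal_defect_Cstar] it suffices to treat the generators psi t, whose defects are psi t - pi
   t. A kernel element is its own defect, so minimality follows. *)
- have defect J : closed_ideal B J -> [set psi t - pi t | t in A] `<=` J ->
      forall s, B s -> J (s - G s).
    move=> idJ hJ s Bs.
    suff /(_ s Bs)[] : B `<=` [set s | [/\ B s, J (s - G s) &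
      J (adjoint s - G (adjoint s))]] by [].
    apply: Cstar_min; first exact: ideal_defect_Cstar csB retr PB GB _ idJ.
    move=> _ [t At <-]; have At' : A (adjoint t) by exact: (Cstar_adjoint csA).
    rewrite /= -(ucp_adjoint csA A1 upsi At) !Gpsi//.
    by split; [exact: Bpsi | apply: hJ; exists t | apply: hJ;
      exists (adjoint t)].
  split; first exact: ker_closed_ideal.
    move=> _ [t At <-]; have [Bpi Gpi] := piB t At.
    have Bp := Bpsi t At; split; first exact: subspaceB sB Bp Bpi.
    by rewrite (linear_onB lG)// Gpsi// Gpi subrr.
  move=> J idJ hJ s [Bs s0]; rewrite -[s]subr0 -s0; exact: defect.
- split; apply/seteqP; split.
  + by move=> _ [s Bs <-]; exact: kerB.
  + by move=> s [Bs s0]; exists s => //; rewrite s0 subr0.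
  + move=> s Bs; exists (s - G s); first exact: kerB.
    by exists (G s); [exact: GB | rewrite subrK].
  + move=> _ [k [Bk _] [p Pp <-]]; exact: subspaceD sB Bk (PB _ Pp).
split=> [eq_psi|iso t At].
  (* If psi and pi agree on A, then B is generated inside the image of pi, where G is the
     identity. *)
  have BP : B `<=` pi @` A.
    apply: Cstar_min => // _ [t At <-]; exists t => //.
    by rewrite eq_psi.
  by move=> s /BP/GP ->.
(* Conversely, psi t - pi t lies in the kernel of G, and an isometry forces it to vanish. *)
have [Bpi Gpi] := piB t At; have Bp := Bpsi t At.
apply/eqP; rewrite -subr_eq0; apply/eqP/opnorm_eq0.
rewrite -iso; last exact: subspaceB sB Bp Bpi.
by rewrite (linear_onB lG)// Gpsi// Gpi subrr opnorm0.
Qed.
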